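(* Let $\mathcal{F}=\mathrm{Lip}_1(\mathbb{X},\mathbb{R})$ be the class of 1-Lipschitz functions $\mathbb{X}\to\mathbb{R}$, with $\mathbb{X}$ a bounded subset of $\mathbb{R}^d$ (with the Euclidean distance). Then there exists a constant $C_d>0$, not depending on $n$ or $m$, such that for every $\mathbb{Q}\in\mathcal{P}(\mathcal{P}(\mathbb{X}))$, $$\mathbb{E}\big(d_{\mathrm{Lip}}(\tilde{\mathbb{Q}}_{(n,m)},\mathbb{Q})\big)\le\begin{cases}C_1\,(n^{-1/2}+m^{-1/2}) & \text{if } d=1,\\ C_2\,(n^{-1/2}\log(n)+m^{-1/2}\log(m)) & \text{if } d=2,\\ C_d\,(n^{-1/d}+m^{-1/d}) & \text{if } d>2.\end{cases}$$
   Context: Standing assumption: $\mathbb{X}$ with its metric is Polish (complete, separable metric space) of finite diameter. $\mathcal{P}(\mathbb{X})$ is the space of Borel probability measures on $\mathbb{X}$ with the weak topology, and $\mathcal{P}(\mathcal{P}(\mathbb{X}))$ the space of Borel probability measures on it. $P(f)=\int f\,\mathrm{d}P$ and $\mathcal{L}(\cdot)$ denotes the law. The Lipschitz hierarchical integral probability metric (Lipschitz HIPM) is $d_{\mathrm{Lip}}(\mathbb{Q}_1,\mathbb{Q}_2)=\sup_{f\in\mathcal{F}}\mathcal{W}(\mathcal{L}(\tilde P_1(f)),\mathcal{L}(\tilde P_2(f)))$, where $\tilde P_i\sim\mathbb{Q}_i$ for $i=1,2$, $\mathcal{F}=\mathrm{Lip}_1(\mathbb{X},\mathbb{R})$, and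 $\mathcal{W}$ is the Wasserstein distance of order 1 on $\mathbb{R}$ with the usual distance. Hierarchical empirical estimator: $n$ and $m$ are sample sizes (positive integers). Let $\tilde P_1,\dots,\tilde P_n$ be i.i.d. with law $\mathbb{Q}$ and, for each $i$, let $X_1^{(i)},\dots,X_m^{(i)}$ be, conditionally on $\tilde P_i$, i.i.d. with law $\tilde P_i$. Set $\tilde P_{i,(m)}=\frac1m\sum_{j=1}^m\delta_{X_j^{(i)}}$ and $\tilde{\mathbb{Q}}_{(n,m)}=\frac1n\sum_{i=1}^n\delta_{\tilde P_{i,(m)}}$, a random element of $\mathcal{P}(\mathcal{P}(\mathbb{X}))$. When evaluating $d_{\mathrm{Lip}}(\tilde{\mathbb{Q}}_{(n,m)},\mathbb{Q})$, the measure $\tilde{\mathbb{Q}}_{(n,m)}$ is taken at a given realization, and $\mathbb{E}$ averages over the realizations.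
   Formalization: For d = 2 the formal theorem assumes n ≥ 2 and m ≥ 2: since log 1 = 0, the stated bound fails when n = 1 or m = 1 (for n = m = 1 its right side is 0 while the expected distance is positive for non-degenerate Q). *)

(* Defs.v *)
From HB Require Import structures.
From mathcomp Require Import all_boot all_order all_algebra.
From mathcomp Require Import all_classical all_reals all_analysis.

Set Implicit Arguments.
Unset Strict Implicit.
Unset Printing Implicit Defensive.

Import Order.TTheory GRing.Theory Num.Theory.
Import numFieldNormedType.Exports.

Local Open Scope classical_set_scope.
Local Open Scope ring_scope.

(* The library norm on 'rV[R]_d is the sup norm, hence this definition. *)
Definition eucl_dist (R : realType) (d : nat) (x y : 'rV[R]_d) : R :=
  Num.sqrt (\sum_(i < d) (x ord0 i - y ord0 i) ^+ 2).

Definition ebounded (R : realType) (d : nat) (X : set 'rV[R]_d) : Prop :=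
  exists D : R, forall x y, X x -> X y -> eucl_dist x y <= D.

(* X as a topological space in its own right (subspace topology). The point x0
   is only there because measurableType requires pointed carriers; neither the
   topology nor anything below depends on its choice. *)
Definition msubset (T : topologicalType) (X : set T) (x0 : X) : Type :=
  set_type X.

HB.instance Definition _ (T : topologicalType) (X : set T) (x0 : X) :=
  Topological.copy (msubset x0) (set_type X).
HB.instance Definition _ (T : topologicalType) (X : set T) (x0 : X) :=
  isPointed.Build (msubset x0) x0.

Definition msubset_dist (R : realType) (d : nat) (X : set 'rV[R]_d) (x0 : X)
    (x y : msubset x0) : R :=
  eucl_dist (set_val x) (set_val y).

Definition borel (T : ptopologicalType) := g_sigma_algebraType (@open T).

Section weak_topology.
Variables (R : realType) (T : ptopologicalType).

Definition bcont := {f : T -> R | continuous f /\ bounded_fun f}.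

HB.instance Definition _ := gen_eqMixin bcont.

Definition weak_eval (P : probability (borel T) R) :
    prod_topology (fun _ : bcont => R) :=
  fun f => \int[P]_(x in [set: borel T]) sval f x.

(* P(T): Borel probability measures with the coarsest topology making
   P |-> P(f) continuous for every bounded continuous f. *)
Definition Prob : Type := initial_topology weak_eval.

HB.instance Definition _ := Topological.copy Prob (initial_topology weak_eval).
HB.instance Definition _ := isPointed.Build Prob (\d_(point : borel T)).

Definition pmeas (P : Prob) : probability (borel T) R := P.

End weak_topology.

Section empirical_measure.
Local Open Scope ereal_scope.
Context d (T : measurableType d) (R : realType).
Variables (k : nat) (k0 : (0 < k)%N) (x : 'I_k -> T).

Definition empirical (A : set T) : \bar R :=
  (k%:R^-1)%:E * \sum_(i < k) \d_(x i) A.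

Let empirical0 : empirical set0 = 0.
Proof. by rewrite /empirical big1 ?mule0// => i _; rewrite measure0. Qed.

Let empirical_ge0 A : 0 <= empirical A.
Proof. by rewrite mule_ge0 ?lee_fin ?invr_ge0// sume_ge0. Qed.

Let empirical_sigma_additive : semi_sigma_additive empirical.
Proof.
move=> F mF tF mUF; rewrite [X in X @ _ --> _](_ : _ = (fun n =>
    (k%:R^-1)%:E * \sum_(i < k) \sum_(0 <= j < n) \d_(x i) (F j))); last first.
  apply/funext => n; rewrite -ge0_sume_distrr; last by move=> j _; exact: sume_ge0.
  by rewrite exchange_big.
apply: cvgeZl => //; apply: cvg_nnesum => i _.
  by apply: nearW => n; exact: sume_ge0.
exact: (@measure_semi_sigma_additive _ _ _ (\d_(x i))).
Qed.

HB.instance Definition _ := isMeasure.Build _ _ _ empirical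
  empirical0 empirical_ge0 empirical_sigma_additive.

Let empirical_setT : empirical [set: T] = 1.
Proof.
rewrite /empirical (eq_bigr (fun=> 1%:E)); last by move=> i _; rewrite diracT.
by rewrite sumEFin -EFinM sumr_const card_ord mulVf// pnatr_eq0 -lt0n.
Qed.

HB.instance Definition _ :=
  Measure_isProbability.Build _ _ _ empirical empirical_setT.

Definition empirical_prob : probability T R := empirical.

End empirical_measure.

Section wasserstein.
Local Open Scope ereal_scope.
Variable R : realType.

(* The marginals are plain set functions, so that a law can be given as the
   pushforward by a map that does not carry a measurability proof. *)
Definition coupling (mu nu : set R -> \bar R)
    (gamma : probability (R * R)%type R) : Prop :=
  (forall A, measurable A -> gamma (fst @^-1` A) = mu A) /\
  (forall A, measurable A -> gamma (snd @^-1` A) = nu A).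

Definition wasserstein1 (mu nu : set R -> \bar R) : \bar R :=
  ereal_inf [set \int[gamma]_z (`|z.1 - z.2|)%:E | gamma in coupling mu nu].

End wasserstein.

Section lipschitz_hipm.
Variables (R : realType) (T : ptopologicalType) (dist : T -> T -> R).

Definition Lip1 : set (T -> R) :=
  [set f | forall x y, `|f x - f y| <= dist x y].

(* The law of P(f) when P has law Q. *)
Definition law_eval (Q : Prob R (Prob R T)) (f : T -> R) : set R -> \bar R :=
  pushforward (pmeas Q)
    (fun P : borel (Prob R T) => \int[pmeas P]_(x in [set: borel T]) f x).

Definition d_Lip (Q1 Q2 : Prob R (Prob R T)) : \bar R :=
  ereal_sup [set wasserstein1 (law_eval Q1 f) (law_eval Q2 f) | f in Lip1].

End lipschitz_hipm.

Section hierarchical_sample.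
Local Open Scope ereal_scope.
Variables (R : realType) (T : ptopologicalType).
Context d (Omega : measurableType d) (mu : probability Omega R).
Variables (n m : nat).
Variables (P : 'I_n -> {RV mu >-> borel (Prob R T)}).
Variables (X : 'I_n -> 'I_m -> {RV mu >-> borel T}).

Definition mutually_independent d' (U : measurableType d') (I : finType)
    (Z : I -> Omega -> U) : Prop :=
  forall E : I -> set U, (forall i, measurable (E i)) ->
    mu (\bigcap_i (Z i @^-1` E i)) = \prod_i mu (Z i @^-1` E i).

Definition block (i : 'I_n) (w : Omega) :
    (borel (Prob R T) * m.-tuple (borel T))%type :=
  (P i w, [tuple X i j w | j < m]).

(* cond_iid says that, given P i, the X i j are independent with law P i:
   both sides agree on every event of the sigma-algebra generated by P i. *)
Record hierarchical_sample (Q : Prob R (Prob R T)) : Prop := {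
  sample_law : forall i A, measurable A -> distribution mu (P i) A = pmeas Q A ;
  sample_cond_iid : forall i (A : set (borel (Prob R T)))
      (B : 'I_m -> set (borel T)),
    measurable A -> (forall j, measurable (B j)) ->
    mu (P i @^-1` A `&` \bigcap_j (X i j @^-1` B j)) =
    \int[mu]_(w in P i @^-1` A) \prod_(j < m) pmeas (P i w) (B j) ;
  sample_indep : mutually_independent block }.

Definition empirical_hier (n0 : (0 < n)%N) (m0 : (0 < m)%N) (w : Omega) :
    Prob R (Prob R T) :=
  empirical_prob R n0 (fun i =>
    (empirical_prob R m0 (fun j => X i j w) : borel (Prob R T))).

End hierarchical_sample.

Definition rate (R : realType) (d n m : nat) : R :=
  if d == 1%N then n%:R `^ (- 2^-1) + m%:R `^ (- 2^-1)
  else if d == 2%N then n%:R `^ (- 2^-1) * ln n%:R + m%:R `^ (- 2^-1) * ln m%:R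
  else n%:R `^ (- d%:R^-1) + m%:R `^ (- d%:R^-1).

(* Main.v *)
Require Import Defs.
From HB Require Import structures.
From mathcomp Require Import all_boot all_order all_algebra.
From mathcomp Require Import all_classical all_reals all_analysis.
From mathcomp Require Import measurable_realfun.
From mathcomp Require Import ring lra zify.

Set Implicit Arguments.
Unset Strict Implicit.
Unset Printing Implicit Defensive.

Import Order.TTheory GRing.Theory Num.Theory.
Import numFieldNormedType.Exports.

Local Open Scope classical_set_scope.
Local Open Scope ring_scope.

(** The expected distance splits into two suprema of empirical processes, and
    one chaining bound controls both.

    On the line, the distance between two laws is the cost of the coupling by
    their quantile functions, and that cost is a difference of integrals of an
    explicit 1-Lipschitz potential [g] ([wasserstein1_le_potential]).  For a
    1-Lipschitz [f], the distance between the laws of [P f] under the estimator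
    and under [Q] is therefore at most the difference of the integrals of the
    functional [P |-> g (P f)].  Replacing each empirical measure by the measure
    [P_i] it was sampled from costs at most the difference of their values at
    [f], since [g] is 1-Lipschitz; what remains is the fluctuation of the i.i.d.
    sample [P_1, ..., P_n] over the class of all functionals [P |-> g (P f)]
    ([d_Lip_le]).

    Both terms concern a sample [Z_1, ..., Z_m] that is i.i.d. conditionally on
    some [P], and the deviations of its averages [h (Z_j)] from the conditional
    mean of [h], uniformly over a class of functions [h].  For a single bounded
    function the moment generating function of the deviation is sub-Gaussian
    ([deviation_mgf]).  The classes have entropy of order [2 ^ (k * d)] at scale
    [2 ^- k]: for 1-Lipschitz functions on a bounded subset of the Euclidean
    space of dimension [d] this is the number of dyadic cubes
    ([bounded_lip_entropy]), and the extra potential [g], which lives in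
    dimension 1, does not change the order ([functional_entropy]).

    Chaining ([chaining]) then adds up one contribution
    [sqrt (2 ^ (k * d) / n) / 2 ^ k] per scale, plus the discretisation error
    [2 ^- K] of the last one.
    With [2 ^ (K * d) <= n < 2 ^ ((K + 1) * d)] that error is of order
    [n ^ (- 1 / d)], and the sum is geometric: its first term dominates when
    [d = 1], its last one when [d > 2], and for [d = 2] all the [K + 1] terms,
    about [ln n] of them, are equal ([chain_sum_rate]).

    Every supremum is bounded by an explicit measurable function, so that the
    estimate holds for the integral of the distance whether or not the distance
    is a measurable function of the realization ([integral_le_majorant]). *)

Definition mfun_of d d' (T : measurableType d) (U : measurableType d')
    (f : T -> U) (mf : measurable_fun [set: T] f) : {mfun T >-> U} :=
  HB.pack f (isMeasurableFun.Build d d' T U f mf).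

(** * Kantorovich duality on the line *)

Section quantile_coupling.
Local Open Scope ereal_scope.
Local Open Scope classical_set_scope.
Variable R : realType.
Implicit Types mu nu : probability R R.

Lemma probability_itvNy_eq mu nu :
  (forall t : R, mu `]-oo, t] = nu `]-oo, t]) ->
  forall A, measurable A -> mu A = nu A.
Proof.
move=> munu A mA.
apply: (@measure_unique _ R R (@RGenOInfty.G R)
  (fun k => `]- k%:R, +oo[%classic)%R).
- exact: RGenOInfty.measurableE.
- move=> _ _ [x ->] [y ->]; exists (Num.max x y).
  apply/seteqP; split => z /=; rewrite !in_itv/= !andbT gt_max.
    by case=> -> ->.
  by move=> /andP[].
- by move=> i; exists (- i%:R)%R.
- rewrite -subTset => x _.
  exists (Num.bound `|x|%R) => //=; rewrite in_itv/= andbT ltrNl.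
  by rewrite (le_lt_trans (ler_norm _))// normrN archi_boundP.
- have itvC (m : probability R R) x : m `]x, +oo[ = 1 - m `]-oo, x].
    by rewrite -probability_setC// setCitvl.
  by move=> _ [x ->]; rewrite [LHS]itvC [RHS]itvC munu.
- by move=> k; rewrite (le_lt_trans (probability_le1 _ _)) ?ltry.
- exact: mA.
Qed.

Lemma cdf_le_limit mu (u : \bar R) (q : R) :
  (forall t, (q < t)%R -> u <= mu `]-oo, t]) -> u <= mu `]-oo, q].
Proof.
move=> h.
pose X : {RV mu >-> R} := mfun_of (@measurable_id _ _ _).
have := @cdf_right_continuous _ _ _ mu X q.
rewrite /cdf /distribution /pushforward => rc.
apply: (cvge_ge _ rc).
near=> t; apply: h; near: t.
exact: nbhs_right_gt.
Unshelve. all: by end_near. Qed.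

(** Truncating the level at 1 keeps the set below nonempty, so that the
    quantile function is nondecreasing on the whole line. *)
Definition quantile mu (l u : R) : R :=
  inf [set t | (l <= t)%R /\ (Num.min u 1)%:E <= mu `]-oo, t]].

Section one_measure.
Variables (mu : probability R R) (l r : R).
Hypothesis mulr : mu `[l, r] = 1.

Lemma cdf_right_end : mu `]-oo, r] = 1.
Proof.
apply/eqP; rewrite eq_le probability_le1//= -mulr le_measure ?inE//.
by apply: subset_itvr.
Qed.

Lemma cdf_left_end t : (t < l)%R -> mu `]-oo, t] = 0.
Proof.
move=> tl; apply/eqP; rewrite eq_le measure_ge0 andbT.
have : mu (~` `[l, r]) = 0 by rewrite probability_setC// mulr subee.
move=> <-; rewrite le_measure ?inE//; first exact: measurableC.
move=> x /=; rewrite !in_itv/= => xt; apply/negP.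
by rewrite negb_and -ltNge (le_lt_trans xt tl).
Qed.

Lemma quantile_set_has_inf u :
  has_inf [set t | (l <= t)%R /\ (Num.min u 1)%:E <= mu `]-oo, t]].
Proof.
have lr : (l <= r)%R.
  rewrite leNgt; apply/negP => rl; move: mulr.
  rewrite set_itv_ge ?bnd_simp -?ltNge// measure0 => /esym/eqP.
  by rewrite onee_eq0.
split; last by exists l => t [].
by exists r; split => //; rewrite cdf_right_end lee_fin ge_min lexx orbT.
Qed.

(** The infimum defining the quantile is attained because distribution
    functions are continuous on the right. *)
Lemma quantile_le u t : (l <= t)%R ->
  (quantile mu l u <= t)%R = ((Num.min u 1)%:E <= mu `]-oo, t]).
Proof.
move=> lt; have [ne lb] := quantile_set_has_inf u.
apply/idP/idP => [qt|ut]; last exact: ge_inf.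
apply: (@le_trans _ _ (mu `]-oo, quantile mu l u])); last first.
  by rewrite le_measure ?inE//; exact: subset_itvl.
apply: cdf_le_limit => s qs.
have [v [lv uv] vs] := inf_lt ne qs.
apply: (le_trans uv); rewrite le_measure ?inE//; apply: subset_itvl.
by rewrite bnd_simp ltW.
Qed.

Lemma quantile_ge_left u : (l <= quantile mu l u)%R.
Proof.
have [ne lb] := quantile_set_has_inf u.
by apply: lb_le_inf => // t [].
Qed.

Lemma quantile_le_right u : (quantile mu l u <= r)%R.
Proof.
have [[t [lt ut]] lb] := quantile_set_has_inf u.
apply: ge_inf => //; split; last first.
  by rewrite cdf_right_end lee_fin ge_min lexx orbT.
rewrite leNgt; apply/negP => rl; move: mulr.
rewrite set_itv_ge ?bnd_simp -?ltNge// measure0 => /esym/eqP.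
by rewrite onee_eq0.
Qed.

Lemma measurable_quantile : measurable_fun [set: R] (quantile mu l).
Proof.
apply: nondecreasing_measurable => //= u v uv.
rewrite quantile_le ?quantile_ge_left//.
apply: (@le_trans _ _ (Num.min v 1)%:E).
  by rewrite lee_fin le_min !ge_min uv lexx orbT.
by rewrite -quantile_le// quantile_ge_left.
Qed.

(** By [quantile_le] the event is the interval of the levels at most
    [mu `]-oo, t]]. *)
Lemma quantile_law t :
  uniform_prob (@ltr01 R) (quantile mu l @^-1` `]-oo, t]) = mu `]-oo, t].
Proof.
have mq : measurable (quantile mu l @^-1` `]-oo, t]).
  by rewrite -[X in measurable X]setTI; exact: measurable_quantile.
have [tl|lt] := ltP t l.
  rewrite cdf_left_end// (_ : _ @^-1` _ = set0) ?measure0// -subset0.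
  move=> u /=; rewrite in_itv/= => /le_lt_trans/(_ tl).
  by rewrite ltNge quantile_ge_left.
set B := _ @^-1` _ in mq *.
set s := fine (mu `]-oo, t]).
have Fs : mu `]-oo, t] = s%:E by rewrite fineK ?fin_num_measure.
have s1 : (s <= 1)%R by rewrite -lee_fin -Fs probability_le1.
have s0 : (0 <= s)%R by rewrite -lee_fin -Fs.
have -> : uniform_prob (@ltr01 R) B = lebesgue_measure (B `&` `[0%R, 1%R]).
  rewrite -[X in uniform_prob _ X]setIT -integral_indic// integral_uniform//.
    by rewrite subr0 invr1 mul1e integral_indic.
  exact/measurable_EFinP/measurable_indic.
have -> : B `&` `[0%R, 1%R] = `[0%R, s].
  apply/seteqP; split => u; rewrite /B /= !in_itv/= quantile_le// Fs lee_fin.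
    by move=> [+ /andP[-> u1]]; rewrite min_l.
  by move=> /andP[-> us]; rewrite (le_trans us s1) ge_min us.
rewrite Fs lebesgue_measure_itv/= lte_fin.
case: ltP => h; first by rewrite -EFinD subr0.
by congr (_%:E); apply/eqP; rewrite eq_le h s0.
Qed.

End one_measure.

Definition cdf_lt_set mu nu : set R := [set t | mu `]-oo, t] < nu `]-oo, t]].

Definition flength (S : set R) : R := fine (lebesgue_measure S).

Definition clamp (l r y : R) : R := Num.max l (Num.min y r).

Lemma clamp_itv l r y : (l <= r)%R -> (l <= clamp l r y <= r)%R.
Proof. by move=> lr; rewrite /clamp le_max lexx ge_max lr ge_min lexx orbT. Qed.

Lemma clamp_id l r y : (l <= y <= r)%R -> clamp l r y = y.
Proof. by move=> /andP[ly yr]; rewrite /clamp min_l// max_r. Qed.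

Lemma clamp_nd l r x y : (x <= y)%R -> (clamp l r x <= clamp l r y)%R.
Proof. by move=> xy; rewrite /clamp; apply: le_max2 => //; exact: le_min2. Qed.

Lemma clampB l r x y : (x <= y)%R -> (l <= r)%R ->
  (clamp l r y - clamp l r x <= y - x)%R.
Proof.
move=> xy lr; rewrite /clamp /Num.max /Num.min.
by case: (ltP y r) => ?; case: (ltP x r) => ?; do !case: ltP => /= ?; lra.
Qed.

(** Between [l] and [r] this function has slope 1 where the distribution
    function of [mu] is the smaller one and slope -1 elsewhere: the optimal
    potential for transporting [mu] to [nu]. *)
Definition potential mu nu (l r y : R) : R :=
  (2 * flength (cdf_lt_set mu nu `&` `[l, clamp l r y[%classic)
   - (clamp l r y - l))%R.

Section two_measures.
Variables (mu nu : probability R R) (l r : R).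
Hypotheses (mulr : mu `[l, r] = 1) (nulr : nu `[l, r] = 1).

Let A := cdf_lt_set mu nu.

Let mA : measurable A.
Proof.
have mF (m : probability R R) : measurable_fun [set: R] (fun t => m `]-oo, t]).
  exact: (@cdf_measurable _ _ _ m (mfun_of (@measurable_id _ _ _))).
by rewrite -[A]setTI; exact: measurable_lte.
Qed.

Let lam_itv a b : (a <= b)%R -> flength `[a, b[ = (b - a)%R.
Proof.
move=> ab; rewrite /flength lebesgue_measure_itv/= lte_fin; case: ltP => //= h.
by apply/esym/eqP; rewrite subr_eq0 eq_le ab h.
Qed.

Let lamA_fin a b : lebesgue_measure (A `&` `[a, b[) \is a fin_num.
Proof.
rewrite ge0_fin_numE//; apply: (@le_lt_trans _ _ (lebesgue_measure `[a, b[)).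
  by rewrite le_measure ?inE//; exact: measurableI.
by rewrite lebesgue_measure_itv/=; case: ifP => _; rewrite ?ltry// -EFinD ltry.
Qed.

Let lamA_itv a b : (a <= b)%R ->
  (0 <= flength (A `&` `[a, b[) <= b - a)%R.
Proof.
move=> ab; rewrite fine_ge0//= -(lam_itv ab) fine_le//.
  rewrite lebesgue_measure_itv/=; case: ifP => _ //.
by rewrite le_measure ?inE//; exact: measurableI.
Qed.

Let lamA_split a b : (l <= a <= b)%R ->
  flength (A `&` `[l, b[) = (flength (A `&` `[l, a[) + flength (A `&` `[a, b[))%R.
Proof.
move=> /andP[la ab]; rewrite /flength -fineD//; congr fine.
rewrite -measureU//; last 3 first.
- exact: measurableI.
- exact: measurableI.
- rewrite -subset0 => x [[_ /=]]; rewrite !in_itv/= => /andP[_ xa] [_ /andP[ax _]].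
  by move: (lt_le_trans xa ax); rewrite ltxx.
congr lebesgue_measure; rewrite -setIUr; congr (_ `&` _).
apply/seteqP; split => x /=; rewrite !in_itv/=.
  by move=> /andP[-> ->]; case: (ltP x a) => _; [left|right].
by case=> /andP[h1 h2]; rewrite ?h1 ?h2 ?(lt_le_trans h2 ab)// (le_trans la h1).
Qed.

Let lr : (l <= r)%R.
Proof.
rewrite leNgt; apply/negP => rl; move: mulr.
by rewrite set_itv_ge ?bnd_simp -?ltNge// measure0 => /esym/eqP; rewrite onee_eq0.
Qed.

Let potentialB x y : (x <= y)%R ->
  (potential mu nu l r y - potential mu nu l r x =
   2 * flength (A `&` `[clamp l r x, clamp l r y[)
   - (clamp l r y - clamp l r x))%R.
Proof.
move=> xy; rewrite /potential -/A.
have /andP[lx _] := clamp_itv x lr.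
by rewrite (@lamA_split (clamp l r x) (clamp l r y)) ?lx ?clamp_nd//; ring.
Qed.

Lemma potential_lip x y :
  (`|potential mu nu l r x - potential mu nu l r y| <= `|x - y|)%R.
Proof.
wlog : x y / (y <= x)%R.
  move=> h; case: (leP y x) => [/h//|/ltW/h]; by rewrite distrC (distrC x).
move=> yx; rewrite potentialB//.
have /andP[h1 h2] := lamA_itv (clamp_nd l r yx).
have := clampB yx lr.
by rewrite (@ger0_norm _ (x - y)%R) ?subr_ge0// ler_norml; lra.
Qed.

(** Between the two quantiles of level [u], one distribution function is below
    [u] and the other is at least [u]; hence the slope of the potential does not
    change sign there. *)
Lemma potential_optimal u :
  (`|quantile mu l u - quantile nu l u| =
   potential mu nu l r (quantile mu l u) - potential mu nu l r (quantile nu l u))%R.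
Proof.
set a := quantile mu l u; set b := quantile nu l u.
have la : (l <= a)%R by apply: quantile_ge_left; exact: mulr.
have lb : (l <= b)%R by apply: quantile_ge_left; exact: nulr.
have ar : (a <= r)%R by apply: quantile_le_right; exact: mulr.
have br : (b <= r)%R by apply: quantile_le_right; exact: nulr.
have [ba|ab] := leP b a.
  rewrite ger0_norm ?subr_ge0// potentialB// !clamp_id ?la ?lb//.
  rewrite (_ : A `&` _ = `[b, a[) ?lam_itv//; first by ring.
  apply/setIidPr => t /=; rewrite in_itv/= => /andP[bt ta].
  have lt := le_trans lb bt.
  move: bt ta; rewrite ltNge !(@quantile_le _ l r)// /A/= -ltNge.
  by move=> h1 /lt_le_trans; exact.
rewrite ltr0_norm ?subr_lt0// -[RHS]opprB potentialB ?(ltW ab)//.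
rewrite !clamp_id ?la ?lb//.
rewrite (_ : A `&` _ = set0); first by rewrite /flength measure0/=; ring.
rewrite -subset0 => t [/= At]; rewrite in_itv/= => /andP[at_ tb].
have lt := le_trans la at_.
move: at_ tb; rewrite ltNge !(@quantile_le _ l r)// -ltNge.
by move=> h1 /lt_le_trans/(_ h1)/(lt_trans At); rewrite ltxx.
Qed.

Lemma quantile_coupling_law (m : probability R R) : m `[l, r] = 1 ->
  forall B, measurable B -> uniform_prob (@ltr01 R) (quantile m l @^-1` B) = m B.
Proof.
move=> mlr B mB.
pose X : {RV uniform_prob (@ltr01 R) >-> R} :=
  @mfun_of _ _ (measurableTypeR R) R _ (measurable_quantile mlr).
apply: (@probability_itvNy_eq (distribution (uniform_prob (@ltr01 R)) X)) => // t.
exact: quantile_law mlr t.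
Qed.

Lemma measurable_potential : measurable_fun [set: R] (potential mu nu l r).
Proof.
apply: continuous_measurable_fun => x.
apply/cvgrPdist_le => e e0; near=> y.
apply: le_trans (potential_lip _ _) _.
by near: y; exact: cvgr_dist_le.
Unshelve. all: by end_near. Qed.

Lemma potential_bounded x : (`|potential mu nu l r x| <= r - l)%R.
Proof.
have /andP[lx xr] := clamp_itv x lr.
have /andP[h1 h2] := lamA_itv lx.
by rewrite /potential -/A ler_norml; lra.
Qed.

(** The pair of quantile functions of a uniform level is a coupling, whose cost
    is computed pointwise by [potential_optimal]. *)
Theorem wasserstein1_le_potential :
  wasserstein1 mu nu <=
  \int[mu]_x (potential mu nu l r x)%:E - \int[nu]_x (potential mu nu l r x)%:E.
Proof.
pose U := uniform_prob (@ltr01 R).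
pose Xm : {RV U >-> R} :=
  @mfun_of _ _ (measurableTypeR R) R _ (measurable_quantile mulr).
pose Xn : {RV U >-> R} :=
  @mfun_of _ _ (measurableTypeR R) R _ (measurable_quantile nulr).
have mX : measurable_fun [set: measurableTypeR R] (fun u => (Xm u, Xn u)).
  apply: measurable_fun_pair; first exact: measurable_quantile mulr.
  exact: measurable_quantile nulr.
pose X : {RV U >-> (R * R)%type} := @mfun_of _ _ (measurableTypeR R) _ _ mX.
pose f := potential mu nu l r.
have iU (Y : R -> R) : measurable_fun [set: R] Y ->
    U.-integrable [set: R] (EFin \o (f \o Y)).
  move=> mY; apply: measurable_bounded_integrable => //.
  - by rewrite -ge0_fin_numE ?fin_num_measure//.
  - by apply: measurableT_comp => //; exact: measurable_potential.
  - exists (r - l)%R; split; first exact: num_real.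
    move=> x /ltW rx y _ /=.
    exact: le_trans (potential_bounded _) rx.
have E (m : probability R R) (Y : {RV U >-> R}) :
    (forall B, measurable B -> U (Y @^-1` B) = m B) ->
    \int[m]_x (f x)%:E = \int[U]_x (f (Y x))%:E.
  move=> UY; rewrite (@eq_measure_integral _ _ _ setT (distribution U Y)).
    rewrite integral_distribution//; last by apply: iU; exact: (measurable_funPT Y).
    by apply/measurable_EFinP; apply: measurable_potential.
  by move=> B mB _; exact/esym/UY.
rewrite (E mu Xm); last exact: quantile_coupling_law.
rewrite (E nu Xn); last exact: quantile_coupling_law.
rewrite -integralB//; last 2 first.
- by apply: iU; exact: measurable_quantile mulr.
- by apply: iU; exact: measurable_quantile nulr.
apply: ge_ereal_inf; exists (\int[distribution U X]_z (`|z.1 - z.2|)%:E).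
  exists (distribution U X) => //; split => B mB.
    exact: (quantile_coupling_law mulr).
  exact: (quantile_coupling_law nulr).
rewrite ge0_integral_distribution//; last first.
  apply/measurable_EFinP; apply: measurableT_comp => //.
  by apply: measurable_funB; [exact: measurable_fst|exact: measurable_snd].
by rewrite le_eqVlt; apply/orP; left; apply/eqP; apply: eq_integral => u _;
  rewrite /= potential_optimal.
Qed.

End two_measures.
End quantile_coupling.

(** * Conditionally independent samples *)

Section conditional_product.
Local Open Scope ereal_scope.
Local Open Scope classical_set_scope.
Import HBNNSimple.

Section one_coordinate.
Context dO dU (Omega : measurableType dO) (U : measurableType dU) (R : realType).
Variables (mu : {measure set Omega -> \bar R}).
Variable kap : Omega -> {measure set U -> \bar R}.
Hypothesis mkap : forall B, measurable B -> measurable_fun [set: Omega] (kap ^~ B).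
Variables (w1 w2 : Omega -> R) (Z : Omega -> U).
Hypotheses (mw1 : measurable_fun [set: Omega] w1)
  (mw2 : measurable_fun [set: Omega] w2) (mZ : measurable_fun [set: Omega] Z).
Hypotheses (w1_ge0 : forall w, (0 <= w1 w)%R) (w2_ge0 : forall w, (0 <= w2 w)%R).
Hypothesis w12 : forall B, measurable B ->
  \int[mu]_w ((w1 w)%:E * (\1_B (Z w))%:E) = \int[mu]_w ((w2 w)%:E * kap w B).

Let change_nnsfun (h : {nnsfun U >-> R}) :
  \int[mu]_w ((w1 w)%:E * (h (Z w))%:E) =
  \int[mu]_w ((w2 w)%:E * \int[kap w]_x (h x)%:E).
Proof.
have mpre y : measurable (h @^-1` [set y]) by exact: measurable_funPTI.
have hpre0 w y : 0 <= y%:E * (\1_(h @^-1` [set y]) (Z w))%:E.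
  exact: nnfun_muleindic_ge0.
have kap0 w y : 0 <= y%:E * kap w (h @^-1` [set y]).
  exact: nnsfun_mulemu_ge0.
transitivity (\int[mu]_w (\sum_(y \in range h)
    ((w1 w)%:E * (y%:E * (\1_(h @^-1` [set y]) (Z w))%:E)))).
  apply: eq_integral => w _; rewrite -ge0_mule_fsumr//; congr (_ * _).
  rewrite fimfunE -fsumEFin//.
have mi y : measurable_fun [set: Omega] (fun w => (\1_(h @^-1` [set y]) (Z w))%:E).
  apply/measurable_EFinP; apply: measurableT_comp => //.
rewrite ge0_integral_fsum//; last 2 first.
- move=> y; apply: emeasurable_funM; first exact/measurable_EFinP.
  by apply: measurable_funeM.
- by move=> y w _; rewrite mule_ge0// lee_fin.
transitivity (\int[mu]_w (\sum_(y \in range h)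
    ((w2 w)%:E * (y%:E * kap w (h @^-1` [set y]))))); last first.
  apply: eq_integral => w _; rewrite -ge0_mule_fsumr//; congr (_ * _).
  by rewrite integralT_nnsfun sintegralE.
rewrite ge0_integral_fsum//; last 2 first.
- move=> y; apply: emeasurable_funM; first exact/measurable_EFinP.
  by apply: measurable_funeM; exact: mkap.
- by move=> y w _; rewrite mule_ge0// lee_fin.
apply: eq_fsbigr => y; rewrite inE => -[x _ <-].
under eq_integral do rewrite muleCA.
rewrite ge0_integralZl_EFin//; last 2 first.
- by move=> w _; rewrite mule_ge0// lee_fin.
- by apply: emeasurable_funM => //; exact/measurable_EFinP.
under [RHS]eq_integral do rewrite muleCA.
rewrite ge0_integralZl_EFin//; last 2 first.
- by move=> w _; rewrite mule_ge0// lee_fin.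
- by apply: emeasurable_funM; [exact/measurable_EFinP|exact: mkap].
by rewrite w12.
Qed.

(** The identity extends from indicators to simple functions by linearity, and
    then to [psi] by monotone convergence on both sides. *)
Lemma integral_disintegration (psi : U -> R) :
  measurable_fun [set: U] psi -> (forall x, (0 <= psi x)%R) ->
  \int[mu]_w ((w1 w)%:E * (psi (Z w))%:E) =
  \int[mu]_w ((w2 w)%:E * \int[kap w]_x (psi x)%:E).
Proof.
move=> mpsi psi0.
have mpsiE : measurable_fun [set: U] (EFin \o psi) by exact/measurable_EFinP.
pose h := nnsfun_approx measurableT mpsiE.
have hE x : (h n x)%:E @[n --> \oo] --> (psi x)%:E.
  by apply: (@cvg_nnsfun_approx _ _ _ _ measurableT _ mpsiE) => // y _; rewrite lee_fin.
have ndh x n p : (n <= p)%N -> (h n x <= h p x)%R.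
  by move=> np; have /lefP := nd_nnsfun_approx measurableT mpsiE np.
have mh n : measurable_fun [set: Omega] (fun w => (h n (Z w))%:E).
  by apply/measurable_EFinP; apply: measurableT_comp.
have -> : \int[mu]_w ((w1 w)%:E * (psi (Z w))%:E) =
    limn (fun n => \int[mu]_w ((w1 w)%:E * (h n (Z w))%:E)).
  rewrite -monotone_convergence//; last 3 first.
  - by move=> n; apply: emeasurable_funM => //; exact/measurable_EFinP.
  - by move=> n w _; rewrite mule_ge0// lee_fin.
  - by move=> w _ n p np; rewrite lee_wpmul2l ?lee_fin// ndh.
  apply: eq_integral => w _; apply/esym/cvg_lim => //.
  exact: cvgeZl.
have mkh n : measurable_fun [set: Omega] (fun w => \int[kap w]_x (h n x)%:E).
  apply: measurable_fun_integral_kernel => //; first by move=> x; rewrite lee_fin.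
  exact/measurable_EFinP.
have -> : \int[mu]_w ((w2 w)%:E * \int[kap w]_x (psi x)%:E) =
    limn (fun n => \int[mu]_w ((w2 w)%:E * \int[kap w]_x (h n x)%:E)).
  rewrite -monotone_convergence//; last 3 first.
  - by move=> n; apply: emeasurable_funM => //; exact/measurable_EFinP.
  - move=> n w _; rewrite mule_ge0// ?lee_fin// integral_ge0// => x _.
    by rewrite lee_fin.
  - move=> w _ n p np; rewrite lee_wpmul2l ?lee_fin//; apply: ge0_le_integral => //.
    + by move=> x _; rewrite lee_fin.
    + exact/measurable_EFinP.
    + exact/measurable_EFinP.
    + by move=> x _; rewrite lee_fin ndh.
  apply: eq_integral => w _; apply/esym/cvg_lim => //.
  apply: cvgeZl => //.
  have -> : \int[kap w]_x (psi x)%:E = \int[kap w]_x limn (fun n => (h n x)%:E).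
    by apply: eq_integral => x _; apply/esym/cvg_lim.
  apply: cvg_monotone_convergence => //.
  - by move=> n; exact/measurable_EFinP.
  - by move=> n x _; rewrite lee_fin.
  - by move=> x _ n p np; rewrite lee_fin ndh.
by congr (limn _); apply/funext => n; exact: change_nnsfun.
Qed.

End one_coordinate.

Lemma indic_bigcap (R : realType) (I : finType) (T : Type) (F : I -> set T) w :
  \1_(\bigcap_i F i) w = (\prod_i \1_(F i) w)%R :> R.
Proof.
rewrite indicE; have [|nF] := boolP (w \in \bigcap_i F i).
  rewrite inE => Fw; rewrite big1// => i _.
  by rewrite indicE mem_set//; exact: Fw.
have [i niF] : exists i, ~ F i w.
  by apply/existsNP => Fw; move/negP: nF; apply; rewrite inE => i _.
by rewrite (bigD1 i)//= indicE memNset// mul0r.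
Qed.

(** Squaring [1 - x / 2 <= expR (- (x / 2))] bounds [expR x] by
    [(1 - x / 2) ^- 2]. *)
Lemma expR_le_quadratic (R : realType) (x : R) : (x <= 1)%R ->
  (expR x <= x + 1 + 2 * x ^+ 2)%R.
Proof.
move=> x1.
pose y : R := (1 - x / 2)%R; pose e : R := expR (- (x / 2)).
have y0 : (0 < y)%R by rewrite /y; lra.
have ye : (y <= e)%R by rewrite (le_trans _ (expR_ge1Dx _)).
have xe : (expR x * e ^+ 2 = 1)%R.
  by rewrite -expRM_natl -expRD -[RHS](@expR0 R); congr expR; field.
rewrite -(ler_pM2r (exprn_gt0 2 y0)) (@le_trans _ _ 1%R)//.
  by rewrite -[leRHS]xe ler_wpM2l ?expR_ge0// lerXn2r ?nnegrE ?expR_ge0// ltW.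
rewrite /y -subr_ge0.
have -> : ((x + 1 + 2 * x ^+ 2) * (1 - x / 2) ^+ 2 - 1 =
    x ^+ 2 * ((1 - x) * (5 / 2 - x) / 2))%R by field.
by rewrite mulr_ge0 ?sqr_ge0// divr_ge0// mulr_ge0; lra.
Qed.

Section sample.
Context dO dV dU (Omega : measurableType dO) (V : measurableType dV)
  (U : measurableType dU) (R : realType).
Variables (mu : probability Omega R) (kap : V -> probability U R).
Hypothesis mkap : forall B, measurable B -> measurable_fun [set: V] (fun v => kap v B).
Variables (m : nat) (P : {RV mu >-> V}) (Z : 'I_m -> {RV mu >-> U}).
Hypothesis ciid : forall A (B : 'I_m -> set U),
  measurable A -> (forall j, measurable (B j)) ->
  mu (P @^-1` A `&` \bigcap_j (Z j @^-1` B j)) =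
  \int[mu]_(w in P @^-1` A) \prod_(j < m) kap (P w) (B j).

Section bounded_fun.
Variables (psi : U -> R) (M : R).
Hypotheses (mpsi : measurable_fun [set: U] psi) (psi0 : forall x, (0 <= psi x)%R)
  (psiM : forall x, (psi x <= M)%R).

Let kint v : R := (\int[kap v]_x psi x)%R.

Let psi_integrable v : (kap v).-integrable [set: U] (EFin \o psi).
Proof.
apply: measurable_bounded_integrable => //.
  exact: fin_num_fun_lty.
exists M; split; first exact: num_real.
by move=> x /ltW Mx y _ /=; rewrite ger0_norm// (le_trans _ Mx).
Qed.

Let kintE v : (kint v)%:E = \int[kap v]_x (psi x)%:E.
Proof. by rewrite /kint /Rintegral fineK//; exact: integrable_fin_num (psi_integrable v). Qed.

Let kint0 v : (0 <= kint v)%R.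
Proof. by apply: Rintegral_ge0. Qed.

Lemma measurable_kernel_mean_ge0 : measurable_fun [set: V] (fun v => \int[kap v]_x psi x)%R.
Proof.
rewrite -/kint.
apply/measurable_EFinP; rewrite [X in measurable_fun _ X](_ : _ =
    (fun v => \int[kap v]_x (psi x)%:E)); last by apply/funext => v /=; rewrite kintE.
apply: measurable_fun_integral_kernel => //; exact/measurable_EFinP.
Qed.

Let mkint := measurable_kernel_mean_ge0.

Let mkapfine B : measurable B -> measurable_fun [set: V] (fun v => fine (kap v B)).
Proof.
move=> mB; apply/measurable_EFinP; rewrite [X in measurable_fun _ X](_ : _ =
    (fun v => kap v B)); first exact: mkap.
by apply/funext => v /=; rewrite fineK// fin_num_measure.
Qed.

(** The products below carry [psi] in the first [k] coordinates and an
    indicator in the others; conditional independence is the case [k = 0]. *)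
Let sample_k (k : nat) (B : 'I_m -> set U) (j : 'I_m) x : R :=
  if (j < k)%N then psi x else \1_(B j) x.
Let kint_k (k : nat) (B : 'I_m -> set U) (j : 'I_m) v : R :=
  if (j < k)%N then kint v else fine (kap v (B j)).

Let sample_k0 k B j x : (0 <= sample_k k B j x)%R.
Proof. by rewrite /sample_k; case: ifP. Qed.

Let kint_k0 k B j x : (0 <= kint_k k B j x)%R.
Proof. by rewrite /kint_k; case: ifP => // _; rewrite fine_ge0. Qed.

Let msample_k k B j : measurable (B j) -> measurable_fun [set: U] (sample_k k B j).
Proof. by rewrite /sample_k => mB; case: (j < k)%N => //; exact: measurable_indic. Qed.

Let mkint_k k B j : measurable (B j) -> measurable_fun [set: V] (kint_k k B j).
Proof. by rewrite /kint_k => mB; case: (j < k)%N => //; exact: mkapfine. Qed.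

Let prod_step k A (B : 'I_m -> set U) : (k <= m)%N -> measurable A ->
  (forall j, measurable (B j)) ->
  \int[mu]_w (\1_A (P w) * \prod_(j < m) sample_k k B j (Z j w))%:E =
  \int[mu]_w (\1_A (P w) * \prod_(j < m) kint_k k B j (P w))%:E.
Proof.
move=> + mA; move: B; elim: k => [|k IH] B => [_|km] mB.
  transitivity (mu (P @^-1` A `&` \bigcap_j (Z j @^-1` B j))).
    rewrite -[X in mu X]setIT -integral_indic//; last first.
      apply: measurableI; first exact: measurable_funPTI.
      by apply: fin_bigcap_measurable => // j _; exact: measurable_funPTI.
    apply: eq_integral => w _; congr (_%:E).
    by rewrite indicI/= indic_bigcap.
  rewrite ciid// integral_mkcond epatch_indic; apply: eq_integral => w _ /=.
  rewrite EFinM muleC; congr (_ * _).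
  rewrite -prodEFin; apply: eq_bigr => j _.
  by rewrite /kint_k ltn0 fineK// fin_num_measure.
pose jk := Ordinal km.
have ltE j : j != jk -> (j < k.+1)%N = (j < k)%N.
  by move=> jjk; rewrite ltnS leq_eqVlt -[X in X || _]/(j == jk) (negbTE jjk).
have sE w : (\1_A (P w) * \prod_(j < m) sample_k k.+1 B j (Z j w) =
    (\1_A (P w) * \prod_(j < m | j != jk) sample_k k B j (Z j w)) * psi (Z jk w))%R.
  rewrite (bigD1 jk)//= {1}/sample_k ltnSn mulrCA mulrC; congr (_ * _ * _)%R.
  by apply: eq_bigr => j jjk; rewrite /sample_k ltE.
have kE w : (\1_A (P w) * \prod_(j < m) kint_k k.+1 B j (P w) =
    (\1_A (P w) * \prod_(j < m | j != jk) kint_k k B j (P w)) * kint (P w))%R.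
  rewrite (bigD1 jk)//= {1}/kint_k ltnSn mulrCA mulrC; congr (_ * _ * _)%R.
  by apply: eq_bigr => j jjk; rewrite /kint_k ltE.
under eq_integral do rewrite sE EFinM.
under [RHS]eq_integral do rewrite kE EFinM kintE.
apply: (@integral_disintegration _ _ _ _ _ _ (fun w => kap (P w))) => //.
- move=> E mE; apply: (@measurableT_comp _ _ _ _ _ _ (kap ^~ E)) => //; exact: mkap.
- apply: measurable_funM.
    by apply: measurableT_comp => //; exact: measurable_indic.
  under eq_fun do rewrite -big_filter.
  apply: measurable_prod => j _; apply: measurableT_comp => //.
  exact: msample_k.
- apply: measurable_funM.
    by apply: measurableT_comp => //; exact: measurable_indic.
  under eq_fun do rewrite -big_filter.
  apply: measurable_prod => j _; apply: measurableT_comp => //.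
  exact: mkint_k.
- by move=> w; rewrite mulr_ge0// prodr_ge0.
- by move=> w; rewrite mulr_ge0// prodr_ge0.
move=> E mE.
pose B' j := if j == jk then E else B j.
have mB' j : measurable (B' j) by rewrite /B'; case: ifP.
have sB' w : (\1_A (P w) * \prod_(j < m) sample_k k B' j (Z j w) =
    (\1_A (P w) * \prod_(j < m | j != jk) sample_k k B j (Z j w)) * \1_E (Z jk w))%R.
  rewrite (bigD1 jk)//= {1}/sample_k ltnn {1}/B' eqxx mulrCA mulrC.
  congr (_ * _ * _)%R; apply: eq_bigr => j jjk.
  by rewrite /sample_k /B' (negbTE jjk).
have kB' w : (\1_A (P w) * \prod_(j < m) kint_k k B' j (P w) =
    (\1_A (P w) * \prod_(j < m | j != jk) kint_k k B j (P w)) * fine (kap (P w) E))%R.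
  rewrite (bigD1 jk)//= {1}/kint_k ltnn {1}/B' eqxx mulrCA mulrC.
  congr (_ * _ * _)%R; apply: eq_bigr => j jjk.
  by rewrite /kint_k /B' (negbTE jjk).
transitivity (\int[mu]_w (\1_A (P w) * \prod_(j < m) sample_k k B' j (Z j w))%:E).
  by apply: eq_integral => w _; rewrite sB' EFinM.
rewrite (IH B' (ltnW km) mB'); apply: eq_integral => w _.
by rewrite kB' EFinM fineK// fin_num_measure.
Qed.

(** Conditionally on [P] the sample is independent, hence the expectation of a
    product of functions of the coordinates factorises inside. *)
Lemma integral_conditional_product (phi : V -> R) :
  measurable_fun [set: V] phi -> (forall v, (0 <= phi v)%R) ->
  \int[mu]_w (phi (P w) * \prod_(j < m) psi (Z j w))%:E =
  \int[mu]_w (phi (P w) * (\int[kap (P w)]_x psi x) ^+ m)%:E.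
Proof.
move=> mphi phi0.
transitivity (\int[mu]_w ((kint (P w) ^+ m)%:E * \int[\d_(P w)]_x (phi x)%:E)).
  under eq_integral do rewrite mulrC EFinM.
  apply: (@integral_disintegration _ _ _ _ _ _ (fun w => \d_(P w))) => //.
  - move=> E mE; apply: (@measurableT_comp _ _ _ _ _ _ (fun v => \d_v E)) => //.
    exact: measurable_fun_dirac.
  - by apply: measurable_prod => j _; exact: measurableT_comp.
  - by apply: measurable_funX; exact: measurableT_comp.
  - by move=> w; rewrite prodr_ge0.
  - by move=> w; rewrite exprn_ge0.
  move=> E mE; have := @prod_step m E (fun=> set0) (leqnn _) mE (fun=> measurable0).
  move=> h; transitivity (\int[mu]_w (\1_E (P w) *
      \prod_(j < m) sample_k m (fun=> set0) j (Z j w))%:E).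
    apply: eq_integral => w _; rewrite mulrC -EFinM; congr (_ * _)%:E.
    by apply: eq_bigr => j _; rewrite /sample_k ltn_ord.
  rewrite h; apply: eq_integral => w _; rewrite mulrC EFinM.
  congr (_%:E * _); rewrite (eq_bigr (fun=> kint (P w))).
    by rewrite prodr_const card_ord.
  by move=> j _; rewrite /kint_k ltn_ord.
apply: eq_integral => w _; rewrite integral_dirac//; last exact/measurable_EFinP.
by rewrite diracT mul1e -EFinM mulrC.
Qed.

End bounded_fun.

Section deviation.
Variables (h : U -> R) (b : R).
Hypotheses (mh : measurable_fun [set: U] h) (hb : forall x, (`|h x| <= b)%R).

Lemma bounded_kernel_integrable v : (kap v).-integrable [set: U] (EFin \o h).
Proof.
apply: measurable_bounded_integrable => //.
  exact: fin_num_fun_lty.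
exists b; split; first exact: num_real.
by move=> x /ltW Mx y _ /=; rewrite (le_trans _ Mx).
Qed.

Lemma kernel_mean_bound v : (`|\int[kap v]_x h x| <= b)%R.
Proof.
rewrite (le_trans (le_normr_Rintegral _ _))//; first exact: bounded_kernel_integrable.
apply: (@le_trans _ _ (\int[kap v]_x b)%R).
  apply: le_Rintegral => //.
  - exact/integrable_norm/bounded_kernel_integrable.
  - exact: finite_measure_integrable_cst.
by rewrite Rintegral_cst// [X in fine X](@probability_setT _ _ _ (kap v)) mulr1.
Qed.

Lemma measurable_kernel_mean : measurable_fun [set: V] (fun v => \int[kap v]_x h x)%R.
Proof.
have hb0 x : (0 <= h x + b)%R by move: (hb x); rewrite ler_norml; lra.
have hb2 x : (h x + b <= 2 * b)%R by move: (hb x); rewrite ler_norml; lra.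
rewrite (_ : (fun v => _) = (fun v => \int[kap v]_x (h x + b) - b)%R).
  apply: measurable_funB => //.
  by apply: measurable_kernel_mean_ge0 => //; exact: measurable_funD.
apply/funext => v; rewrite RintegralD//=.
- by rewrite Rintegral_cst// [X in fine X](@probability_setT _ _ _ (kap v)) mulr1 addrK.
- exact: bounded_kernel_integrable.
- exact: finite_measure_integrable_cst.
Qed.

Definition deviation (w : Omega) : R :=
  (m%:R^-1 * \sum_(j < m) h (Z j w) - \int[kap (P w)]_x h x)%R.

Lemma measurable_deviation : measurable_fun [set: Omega] deviation.
Proof.
apply: measurable_funB; last first.
  by apply: (measurableT_comp measurable_kernel_mean).
apply: measurable_funM => //; apply: measurable_sum => j.
exact: measurableT_comp.
Qed.

Lemma kernel_mgf s v : (0 <= s)%R -> (s * b <= 1)%R ->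
  (\int[kap v]_x expR (s * h x) <=
   expR (s * (\int[kap v]_x h x) + 2 * (s * b) ^+ 2))%R.
Proof.
move=> s0 sb.
have ih := bounded_kernel_integrable v.
have ish : (kap v).-integrable [set: U] (EFin \o (fun x => s * h x)%R).
  by have := integrableZl measurableT s ih.
have ic c : (kap v).-integrable [set: U] (EFin \o (fun=> c)).
  exact: finite_measure_integrable_cst.
apply: (@le_trans _ _ (\int[kap v]_x (s * h x + (1 + 2 * (s * b) ^+ 2)))%R).
  apply: le_Rintegral => //.
  - apply: measurable_bounded_integrable => //.
    + exact: fin_num_fun_lty.
    + by apply: measurableT_comp => //; exact: measurable_funM.
    + exists (expR (s * b)); split; first exact: num_real.
      move=> x /ltW Mx y _ /=; rewrite ger0_norm ?expR_ge0// (le_trans _ Mx)//.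
      by rewrite ler_expR ler_wpM2l// (le_trans (ler_norm _)).
  - exact: (integrableD measurableT ish (ic _)).
  - move=> x _.
    have shb : (`|s * h x| <= s * b)%R by rewrite normrM ger0_norm// ler_wpM2l.
    have sh1 : (s * h x <= 1)%R by rewrite (le_trans _ sb)// (le_trans (ler_norm _)).
    rewrite (le_trans (expR_le_quadratic sh1))// -addrA lerD2l lerD2l ler_wpM2l//.
    by rewrite -real_normK ?num_real// lerXn2r ?nnegrE// (le_trans _ shb).
rewrite RintegralD//.
rewrite Rintegral_cst// [X in fine X](@probability_setT _ _ _ (kap v)) mulr1.
rewrite RintegralZl// addrCA; exact: expR_ge1Dx.
Qed.

(** Conditionally on [P] the exponential of the deviation is a product of [m]
    independent factors; the linear terms of their expectations cancel against
    the centring, and the quadratic terms add up. *)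
Lemma deviation_mgf lam : (0 < m)%N -> (0 <= lam)%R -> (lam * b <= m%:R)%R ->
  \int[mu]_w (expR (lam * deviation w))%:E <=
  (expR (2 * (lam * b) ^+ 2 / m%:R))%:E.
Proof.
move=> m0 lam0 lamb; have m0R : (0 < m%:R :> R)%R by rewrite ltr0n.
pose s := (lam / m%:R)%R.
have s0 : (0 <= s)%R by rewrite divr_ge0// ltW.
have sb : (s * b <= 1)%R by rewrite mulrAC ler_pdivrMr// mul1r.
have lamE : (lam = s * m%:R)%R by rewrite /s divfK// gt_eqF.
have me : measurable_fun [set: U] (fun x => expR (s * h x)).
  by apply: measurableT_comp => //; exact: measurable_funM.
have mphi : measurable_fun [set: V] (fun v => expR (- lam * \int[kap v]_x h x))%R.
  by apply: measurableT_comp => //; apply: measurable_funM => //; exact: measurable_kernel_mean.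
under eq_integral => w _.
  rewrite (_ : expR _ = expR (- lam * \int[kap (P w)]_x h x)%R *
     \prod_(j < m) expR (s * h (Z j w)))%R; last first.
    rewrite -expR_sum -expRD; congr expR.
    rewrite /deviation mulrBr mulrA -/s mulr_sumr.
    by rewrite mulNr addrC.
  over.
rewrite (@integral_conditional_product (fun x => expR (s * h x))
  (expR (s * b)) _ _ _ (fun v => expR (- lam * \int[kap v]_x h x)%R))//;
  last first.
  by move=> x; rewrite ler_expR ler_wpM2l// (le_trans (ler_norm _)).
rewrite -[leRHS]mule1 -(@probability_setT _ _ _ mu) -integral_cst//.
apply: ge0_le_integral => //.
- move=> w _; rewrite lee_fin mulr_ge0 ?expR_ge0// exprn_ge0//.
  by apply: Rintegral_ge0 => x _; exact: expR_ge0.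
- apply/measurable_EFinP; apply: measurable_funM.
    exact: (measurableT_comp mphi).
  apply: measurable_funX; apply: (measurableT_comp
    (@measurable_kernel_mean_ge0 _ (expR (s * b)) _ _ _)) => //.
  by move=> x; rewrite ler_expR ler_wpM2l// (le_trans (ler_norm _)).
move=> w _; rewrite lee_fin.
apply: (@le_trans _ _ (expR (- lam * \int[kap (P w)]_x h x) *
   (expR (s * (\int[kap (P w)]_x h x) + 2 * (s * b) ^+ 2)) ^+ m))%R.
  apply: ler_wpM2l; first exact: expR_ge0.
  apply: lerXn2r; [rewrite nnegrE|by rewrite nnegrE expR_ge0|exact: kernel_mgf].
  by apply: Rintegral_ge0 => x _; exact: expR_ge0.
rewrite -expRM_natl -expRD ler_expR lamE.
rewrite le_eqVlt; apply/orP; left; apply/eqP.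
by field; rewrite gt_eqF.
Qed.

End deviation.
End sample.

End conditional_product.

(** * Chaining *)

Section finite_maximum.
Context d (Omega : measurableType d) (R : realType) (mu : probability Omega R).
Local Open Scope ereal_scope.

(** Since [t <= expR t], every [lam * Y j] is at most [L + expR (lam * Y j - L)].
    Summing the exponentials gives a measurable bound on all the [Y j], and
    [L = a + c] makes the expectation of the sum at most 1. *)
Lemma finite_max_mgf (J : finType) (Y : J -> Omega -> R) (lam a c : R) :
  (0 < lam)%R -> (0 <= a)%R -> (0 <= c)%R -> (#|J|%:R <= expR a)%R ->
  (forall j, measurable_fun [set: Omega] (Y j)) ->
  (forall j, \int[mu]_w (expR (lam * Y j w))%:E <= (expR c)%:E) ->
  exists G : Omega -> R, [/\ measurable_fun [set: Omega] G,
    forall w, (0 <= G w)%R, forall j w, (Y j w <= G w)%R &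
    \int[mu]_w (G w)%:E <= ((a + c + 1) / lam)%:E].
Proof.
move=> lam0 a0 c0 Ja mY Yc; pose L := (a + c)%R.
have meY j : measurable_fun [set: Omega] (fun w => expR (lam * Y j w)).
  by apply: measurableT_comp => //; exact: measurable_funM.
have e0 j w : (0 <= expR (lam * Y j w - L))%R by exact: expR_ge0.
exists (fun w => lam^-1 * (L + expR (- L) * \sum_(j : J) expR (lam * Y j w)))%R.
have sumE w : (expR (- L) * \sum_(j : J) expR (lam * Y j w) =
    \sum_(j : J) expR (lam * Y j w - L))%R.
  by rewrite mulr_sumr; apply: eq_bigr => j _; rewrite -expRD addrC.
have mS : measurable_fun [set: Omega] (fun w => \sum_(j : J) expR (lam * Y j w))%R.
  exact: measurable_sum.
split.
- apply: measurable_funM => //; apply: measurable_funD => //.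
  exact: measurable_funM.
- move=> w; rewrite mulr_ge0 ?invr_ge0 ?(ltW lam0)// addr_ge0 ?addr_ge0//.
  by rewrite mulr_ge0 ?expR_ge0// sumr_ge0// => j _; exact: expR_ge0.
- move=> j w; rewrite mulrC ler_pdivlMr// mulrC sumE (bigD1 j)//=.
  have := expR_ge1Dx (lam * Y j w - L).
  have : (0 <= \sum_(i | i != j) expR (lam * Y i w - L))%R by rewrite sumr_ge0.
  by lra.
under eq_integral do rewrite EFinM EFinD EFinM -sumEFin.
rewrite ge0_integralZl_EFin//; last 3 first.
- move=> w _; rewrite adde_ge0 ?lee_fin ?addr_ge0//.
  by rewrite mule_ge0 ?lee_fin ?expR_ge0// sume_ge0// => j _; rewrite lee_fin expR_ge0.
- apply: emeasurable_funD => //; apply: measurable_funeM.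
  by apply: emeasurable_sum => j; exact/measurable_EFinP.
- by rewrite invr_ge0 ltW.
rewrite mulrC EFinM lee_pmul2l ?lte_fin ?invr_gt0//.
rewrite ge0_integralD//; last 3 first.
- by move=> w _; rewrite lee_fin addr_ge0.
- move=> w _.
  by rewrite mule_ge0 ?lee_fin ?expR_ge0// sume_ge0// => j _; rewrite lee_fin expR_ge0.
- apply: measurable_funeM.
  by apply: emeasurable_sum => j; exact/measurable_EFinP.
rewrite integral_cst// [X in _ * X](@probability_setT _ _ _ mu) mule1.
rewrite [leRHS]EFinD leeD2l//.
rewrite ge0_integralZl_EFin//; last 2 first.
- by move=> w _; rewrite sume_ge0// => j _; rewrite lee_fin expR_ge0.
- by apply: emeasurable_sum => j; exact/measurable_EFinP.
rewrite ge0_integral_sum//; last by move=> j; exact/measurable_EFinP.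
apply: (@le_trans _ _ ((expR (- L))%:E * \sum_(j : J) (expR c)%:E)).
  by rewrite lee_wpmul2l ?lee_fin ?expR_ge0// lee_sum.
rewrite sumEFin sumr_const -EFinM lee_fin -mulr_natl.
apply: (@le_trans _ _ (expR (- L) * (expR a * expR c)))%R.
  by rewrite ler_wpM2l ?expR_ge0// ler_wpM2r ?expR_ge0.
by rewrite -!expRD addNr expR0.
Qed.

End finite_maximum.

(** Metric entropy of dimension [dim] at every dyadic scale: at scale
    [B / 2 ^+ k] the functions of [H] fall into at most
    [expR (a * 2 ^ (k * dim))] classes of uniformly close functions. *)
Definition entropy_le (U : Type) (R : realType) (H : set (U -> R)) (B a : R)
    (dim : nat) : Prop :=
  forall k : nat, exists (N : nat) (code : (U -> R) -> nat),
  [/\ N%:R <= expR (a * (2 ^ (k * dim))%:R),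
      forall h, H h -> (code h < N)%N &
      forall h h', H h -> H h' -> code h = code h' ->
        forall x, `|h x - h' x| <= B / 2 ^+ k].

(** Each scale contributes its size times the square root of the ratio of the
    entropy to the sample size. *)
Definition chain_sum (R : realType) (dim m K : nat) : R :=
  \sum_(k < K.+1) Num.sqrt ((2 ^ (k * dim))%:R / m%:R) / 2 ^+ k.

Section chaining.
Context dO dV dU (Omega : measurableType dO) (V : measurableType dV)
  (U : measurableType dU) (R : realType).
Variables (mu : probability Omega R) (kap : V -> probability U R).
Hypothesis mkap : forall B, measurable B ->
  measurable_fun [set: V] (fun v => kap v B).
Variables (m : nat) (P : {RV mu >-> V}) (Z : 'I_m -> {RV mu >-> U}).
Hypothesis ciid : forall A (B : 'I_m -> set U),
  measurable A -> (forall j, measurable (B j)) ->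
  mu (P @^-1` A `&` \bigcap_j (Z j @^-1` B j)) =
  (\int[mu]_(w in P @^-1` A) \prod_(j < m) kap (P w) (B j))%E.
Hypothesis m0 : (0 < m)%N.
Notation dev := (deviation kap P Z).

Lemma deviationB (h1 h2 : U -> R) b :
  measurable_fun [set: U] h1 -> measurable_fun [set: U] h2 ->
  (forall x, `|h1 x| <= b) -> (forall x, `|h2 x| <= b) ->
  forall w, dev (fun x => h1 x - h2 x) w = dev h1 w - dev h2 w.
Proof.
move=> mh1 mh2 h1b h2b w.
rewrite /deviation sumrB RintegralB//; first by ring.
- exact: (bounded_kernel_integrable kap mh1 h1b).
- exact: (bounded_kernel_integrable kap mh2 h2b).
Qed.

Lemma deviation_le (h : U -> R) b : measurable_fun [set: U] h ->
  (forall x, `|h x| <= b) -> forall w, dev h w <= 2 * b.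
Proof.
move=> mh hb w; rewrite /deviation.
have m0R : 0 < m%:R :> R by rewrite ltr0n.
have : m%:R^-1 * \sum_(j < m) h (Z j w) <= b.
  rewrite ler_pdivrMl//; apply: (@le_trans _ _ (\sum_(j < m) b)).
    by apply: ler_sum => j _; rewrite (le_trans (ler_norm _)).
  by rewrite sumr_const card_ord mulr_natl.
have := kernel_mean_bound kap mh hb (P w).
by rewrite ler_norml => /andP[h1 _] h2; lra.
Qed.

(** The value [lam = sqrt (m * x) / b] balances the entropy term [al * x / lam]
    and the variance term [lam * b ^+ 2 / m]; the condition [x <= m] keeps
    [lam * b / m] in the range of [deviation_mgf]. *)
Lemma finite_family_max (J : finType) (D : J -> U -> R) (al b x : R) :
  0 <= al -> 0 < b -> 1 <= x -> x <= m%:R -> #|J|%:R <= expR (al * x) ->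
  (forall j, measurable_fun [set: U] (D j)) ->
  (forall j u, `|D j u| <= b) ->
  exists G : Omega -> R, [/\ measurable_fun [set: Omega] G,
    forall w, 0 <= G w, forall j w, dev (D j) w <= G w &
    (\int[mu]_w (G w)%:E <= ((al + 3) * b * Num.sqrt (x / m%:R))%:E)%E].
Proof.
move=> al0 b0 x1 xm Jx mD Db.
have m0R : 0 < m%:R :> R by rewrite ltr0n.
have x0 : 0 < x by rewrite (lt_le_trans _ x1).
pose q := Num.sqrt (m%:R * x).
have q0 : 0 < q by rewrite sqrtr_gt0 mulr_gt0.
have q2 : q ^+ 2 = m%:R * x by rewrite sqr_sqrtr// mulr_ge0 ?ltW.
pose lam := q / b.
have lam0 : 0 < lam by rewrite divr_gt0.
have lamb : lam * b = q by rewrite divfK// gt_eqF.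
have qm : q <= m%:R.
  by rewrite -(ler_pXn2r (n := 2))// ?nnegrE ?(ltW q0)// q2 expr2 ler_pM2l.
have mD' j : measurable_fun [set: Omega] (dev (D j)).
  exact: (measurable_deviation mkap P Z (mD j) (Db j)).
have mgfD j : (\int[mu]_w (expR (lam * dev (D j) w))%:E <= (expR (2 * x))%:E)%E.
  rewrite (_ : 2 * x = 2 * (lam * b) ^+ 2 / m%:R); last first.
    by rewrite lamb q2; field; rewrite gt_eqF.
  by apply: (deviation_mgf mkap ciid (mD j) (Db j)) => //; [exact: ltW|rewrite lamb].
have alx0 : 0 <= al * x by rewrite mulr_ge0// ltW.
have xx0 : 0 <= 2 * x by rewrite mulr_ge0// ltW.
have [G [mG G0 GD iG]] := finite_max_mgf lam0 alx0 xx0 Jx mD' mgfD.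
exists G; split => //; apply: (le_trans iG); rewrite lee_fin.
have qE : Num.sqrt (x / m%:R) = x / q.
  apply/eqP; rewrite -(eqrXn2 (n := 2)) ?sqrtr_ge0 ?divr_ge0 ?ltW//.
  rewrite sqr_sqrtr ?divr_ge0 ?ltW// expr_div_n q2; apply/eqP.
  by field; rewrite !gt_eqF.
rewrite qE /lam ler_pdivrMr ?divr_gt0//.
rewrite (_ : _ * (q / b) = (al + 3) * x); last by field; rewrite !gt_eqF.
by nra.
Qed.

Section class.
Variables (H : set (U -> R)) (B a : R) (dim : nat).
Hypotheses (B0 : 0 < B) (a0 : 0 <= a).
Hypotheses (mH : forall h, H h -> measurable_fun [set: U] h)
  (HB : forall h, H h -> forall u, `|h u| <= B).
Hypothesis entH : entropy_le H B a dim.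

(** Every [h] is reached from the coarsest scale by a chain of representatives
    of its classes.  At scale [k] the links form a finite family of size
    [expR (2 * a * 2 ^ (k * dim))] of functions bounded by [3 * B / 2 ^+ k], so
    that [finite_family_max] bounds them all at once; from the last
    representative to [h] the trivial bound suffices. *)
Theorem chaining K : (2 ^ (K * dim) <= m)%N ->
  exists G : Omega -> R, [/\ measurable_fun [set: Omega] G,
    forall w, 0 <= G w, forall h, H h -> forall w, dev h w <= G w &
    (\int[mu]_w (G w)%:E <=
      ((2 * a + 3) * (3 * B) * (chain_sum R dim m K + (2 ^+ K)^-1))%:E)%E].
Proof.
move=> KM; have [N /choice[code codeP]] := choice entH.
pose rep k i := xget (cst 0 : U -> R) [set h | H h /\ code k h = i].
have repH k h : H h -> H (rep k (code k h)) /\ code k (rep k (code k h)) = code k h.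
  by move=> Hh; apply: (@xgetPex _ (cst 0) [set h' | H h' /\ code k h' = code k h]); exists h.
have rep_close k h u : H h -> `|rep k (code k h) u - h u| <= B / 2 ^+ k.
  by move=> Hh; have [H1 H2] := repH k h Hh; have [_ _] := codeP k; exact.
have rep_ok k i : measurable_fun [set: U] (rep k i) /\ forall u, `|rep k i u| <= B.
  rewrite /rep; case: xgetP => [h _ [Hh _]|_]; first by split; [exact: mH|exact: HB].
  by split => [|u]; [exact: measurable_cst|rewrite normr0 ltW].
have mrep k i := (rep_ok k i).1.
have repB k i := (rep_ok k i).2.
have B30 : 0 < 3 * B by rewrite mulr_gt0.
have a20 : 0 <= 2 * a by rewrite mulr_ge0.
pose A0 := (2 * a + 3) * (3 * B).
have net : (2 ^ (K * dim) <= m)%N -> exists G : Omega -> R,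
    [/\ measurable_fun [set: Omega] G, forall w, 0 <= G w,
    forall h, H h -> forall w, dev (rep K (code K h)) w <= G w &
    (\int[mu]_w (G w)%:E <= (A0 * chain_sum R dim m K)%:E)%E].
  elim: K {KM} => [|K IH] Km.
    have card0 : #|'I_(N 0)|%:R <= expR (2 * a * 1) :> R.
      have [+ _ _] := codeP 0; rewrite card_ord mul0n expn0 mulr1 => /le_trans; apply.
      by rewrite ler_expR mulr1; lra.
    have m1 : 1 <= m%:R :> R by rewrite ler1n.
    have repB3 (j : 'I_(N 0)) u : `|rep 0 j u| <= 3 * B.
      by rewrite (le_trans (repB _ _ _))//; lra.
    have [G [mG G0 GD iG]] := finite_family_max a20 B30 (lexx 1) m1 card0
      (fun j : 'I_(N 0) => mrep 0 j) repB3.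
    exists G; split => //.
      move=> h Hh w; have [_ cN _] := codeP 0.
      exact: (GD (Ordinal (cN h Hh))).
    by rewrite (le_trans iG)// /chain_sum big_ord1 mul0n expn0 expr0 divr1.
  have Km' : (2 ^ (K * dim) <= m)%N.
    by rewrite (leq_trans _ Km)// leq_exp2l// leq_mul2r leqnSn orbT.
  have [G [mG G0 GD iG]] := IH Km'.
  pose x : R := (2 ^ (K.+1 * dim))%:R.
  pose b := 3 * B / 2 ^+ K.+1.
  have b0 : 0 < b by rewrite divr_gt0// exprn_gt0.
  pose J := ('I_(N K.+1) * 'I_(N K))%type.
  (* pairs of representatives too far apart to be linked are replaced by 0 *)
  pose close (p : J) := `[< forall u, `|rep K.+1 p.1 u - rep K p.2 u| <= b >].
  pose D (p : J) (u : U) := if close p then rep K.+1 p.1 u - rep K p.2 u else 0.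
  have Db p u : `|D p u| <= b.
    by rewrite /D /close; case: asboolP => // _; rewrite normr0 ltW.
  have mD p : measurable_fun [set: U] (D p).
    rewrite /D; case: (close p); last exact: measurable_cst.
    exact: measurable_funB.
  have x1 : 1 <= x by rewrite ler1n expn_gt0.
  have xm : x <= m%:R by rewrite ler_nat.
  have cardJ : #|{: J}|%:R <= expR (2 * a * x).
    rewrite card_prod !card_ord natrM.
    have [N1 _ _] := codeP K.+1; have [N2 _ _] := codeP K.
    apply: (le_trans (ler_pM (ler0n _ _) (ler0n _ _) N1 N2)).
    rewrite -expRD ler_expR -/x.
    have : (2 ^ (K * dim))%:R <= x.
      by rewrite ler_nat leq_exp2l// leq_mul2r leqnSn orbT.
    by nra.
  have [G' [mG' G0' GD' iG']] := finite_family_max a20 b0 x1 xm cardJ mD Db.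
  exists (fun w => G w + G' w); split.
  - exact: measurable_funD.
  - by move=> w; rewrite addr_ge0.
  - move=> h Hh w.
    have [_ cN _] := codeP K.+1; have [_ cN' _] := codeP K.
    pose p : J := (Ordinal (cN h Hh), Ordinal (cN' h Hh)).
    have cp : close p.
      apply/asboolP => u /=.
      have h1 := rep_close K.+1 h u Hh; have := rep_close K h u Hh.
      rewrite (_ : B / 2 ^+ K = 2 * (B / 2 ^+ K.+1)); last first.
        by rewrite exprS; field; rewrite expf_neq0.
      rewrite /b -mulrA; move: h1; rewrite !ler_norml.
      by move: (B / 2 ^+ K.+1) => e /andP[? ?] /andP[? ?]; apply/andP; split; lra.
    have := GD' p w; rewrite /D cp (deviationB (b := B))// => GD'w.
    by have := GD h Hh w; rewrite /= in GD'w *; lra.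
  under eq_integral do rewrite EFinD.
  rewrite ge0_integralD//; last 4 first.
  - by move=> w _; rewrite lee_fin.
  - exact/measurable_EFinP.
  - by move=> w _; rewrite lee_fin.
  - exact/measurable_EFinP.
  apply: (le_trans (leeD iG iG')); rewrite -EFinD lee_fin.
  have -> : chain_sum R dim m K.+1 = chain_sum R dim m K + Num.sqrt (x / m%:R) / 2 ^+ K.+1.
    by rewrite /chain_sum [LHS]big_ord_recr.
  rewrite [leRHS]mulrDr lerD2l.
  rewrite /A0 /b -/x le_eqVlt; apply/orP; left; apply/eqP.
  by field; rewrite expf_neq0.
have [G [mG G0 GD iG]] := net KM.
exists (fun w => G w + 2 * (B / 2 ^+ K)); split.
- exact: measurable_funD.
- by move=> w; rewrite addr_ge0// mulr_ge0// divr_ge0 ?ltW// exprn_gt0.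
- move=> h Hh w.
  have [mh hb] : measurable_fun [set: U] (fun u => h u - rep K (code K h) u) /\
      forall u, `|h u - rep K (code K h) u| <= B / 2 ^+ K.
    split; first by apply: measurable_funB => //; exact: mH.
    by move=> u; rewrite distrC; exact: rep_close.
  have := deviation_le mh hb w.
  rewrite (deviationB (b := B))//; [|exact: mH|exact: HB].
  by have := GD h Hh w; lra.
under eq_integral do rewrite EFinD.
have e0 : 0 <= 2 * (B / 2 ^+ K) by rewrite mulr_ge0// divr_ge0 ?ltW// exprn_gt0.
rewrite ge0_integralD//; [|by move=> w _; rewrite lee_fin|exact/measurable_EFinP].
rewrite integral_cst// [X in (_ + _ * X)%E](@probability_setT _ _ _ mu) mule1.
apply: (le_trans (leeD iG (lexx _))); rewrite -EFinD lee_fin mulrDr lerD2l -/A0.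
rewrite mulrA ler_pM2r ?invr_gt0 ?exprn_gt0// /A0.
by nra.
Qed.

End class.

End chaining.

(** * Metric entropy of Lipschitz functions *)

(** At scale [delta / 2 ^+ k] the space splits into at most [A * 2 ^ (k * dim)]
    cells, as a bounded subset of a space of dimension [dim] does. *)
Definition grid_le (T : Type) (R : realType) (dist : T -> T -> R) (A : nat)
    (delta : R) (dim : nat) : Prop :=
  forall k : nat, exists (N : nat) (cell : T -> nat),
  [/\ (N <= A * 2 ^ (k * dim))%N, forall x, (cell x < N)%N &
      forall x y, cell x = cell y -> dist x y <= delta / 2 ^+ k].

Definition bounded_lip (T : Type) (R : realType) (dist : T -> T -> R) (D : R) :
    set (T -> R) :=
  [set f | (forall x y, `|f x - f y| <= dist x y) /\ forall x, `|f x| <= D].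

Lemma grid_le_dim (T : Type) (R : realType) (dist : T -> T -> R) A delta dim dim' :
  (dim <= dim')%N -> grid_le dist A delta dim -> grid_le dist A delta dim'.
Proof.
move=> dd h k; have [N [cell [NA cN cd]]] := h k; exists N, cell; split => //.
by rewrite (leq_trans NA)// leq_mul2l leq_exp2l// leq_mul2l dd !orbT.
Qed.

(** The cells are dyadic cubes: two points in the same cube of side [2 ^- k] are
    within [dim / 2 ^+ k] of each other. *)
Lemma coordinates_grid (T : Type) (R : realType) (dim : nat)
    (e : T -> 'I_dim -> R) (dist : T -> T -> R) (D : R) :
  (forall x i, `|e x i| <= D) ->
  (forall x y, dist x y <= \sum_(i < dim) `|e x i - e y i|) ->
  exists A, grid_le dist A dim%:R dim.
Proof.
move=> eD distE.
pose n0 := Num.bound (2 * D).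
exists (n0 ^ dim)%N => k.
pose W := (n0 * 2 ^ k)%N.
pose q x i : R := 2 ^+ k * (e x i + D).
have p0 : 0 < 2 ^+ k :> R by rewrite exprn_gt0.
have q0 x i : 0 <= q x i.
  by rewrite mulr_ge0 ?(ltW p0)//; have := eD x i; rewrite ler_norml; lra.
have qW x i : (Num.truncn (q x i) < W)%N.
  rewrite truncn_lt_nat// /W natrM natrX /q [ltRHS]mulrC ltr_pM2l//.
  apply: (@le_lt_trans _ _ (2 * D)).
    by have := eD x i; rewrite ler_norml; lra.
  apply: archi_boundP; have := eD x i; have := normr_ge0 (e x i); lra.
pose c x : {ffun 'I_dim -> 'I_W} := [ffun i => Ordinal (qW x i)].
exists #|{ffun 'I_dim -> 'I_W}|, (fun x => nat_of_ord (enum_rank (c x))); split => //.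
  by rewrite card_ffun !card_ord /W expnMn -expnM.
move=> x y /ord_inj/enum_rank_inj/ffunP cxy; apply: (le_trans (distE x y)).
apply: (@le_trans _ _ (\sum_(i < dim) (2 ^+ k)^-1)); last first.
  by rewrite sumr_const card_ord mulr_natl.
apply: ler_sum => i _.
have /(congr1 val) := cxy i; rewrite !ffunE /= => txy.
have /andP[h1 h2] := truncn_itv (q0 x i).
have /andP[h3 h4] := truncn_itv (q0 y i).
rewrite txy in h1 h2.
have : `|q x i - q y i| <= 1.
  by move: h1 h2 h3 h4; rewrite -natr1 ler_norml; lra.
have -> : q x i - q y i = 2 ^+ k * (e x i - e y i) by rewrite /q; ring.
by rewrite normrM gtr0_norm// mulrC -ler_pdivlMr// mul1r.
Qed.

Lemma floor_bound (R : realType) (delta D x : R) (n : nat) :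
  2 * delta + D + 2 < n%:R -> `|x| <= 2 * delta + D ->
  (`|Num.floor x| <= n)%N.
Proof.
rewrite -(ler_nat R) natr_absz intr_norm => nP.
have /andP[] := floor_itv x; rewrite intrD mulr1z !ler_norml.
move: ((Num.floor x)%:~R : R) => z h1 h2 /andP[h3 h4].
by apply/andP; split; lra.
Qed.

Lemma floor_increment (R : realType) (delta D x y : R) (n : nat) :
  0 <= D -> 2 * delta + D + 2 < n%:R -> `|x / 2 - y| <= delta ->
  (`|(Num.floor x - 2 * Num.floor y)%R| <= n)%N.
Proof.
rewrite -(ler_nat R) natr_absz intr_norm intrB intrM !intrD !mulr1z => D0 nP.
have /andP[] := floor_itv x; have /andP[] := floor_itv y.
rewrite !intrD !mulr1z !ler_norml.
move: ((Num.floor x)%:~R : R) ((Num.floor y)%:~R : R) => z t h1 h2 h3 h4 /andP[h5 h6].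
by apply/andP; split; lra.
Qed.

Lemma three_steps (R : realType) (x y x' y' p q r : R) :
  `|x - y| <= p -> `|x' - y'| <= p -> `|y - y'| <= q -> 0 <= r ->
  `|x - x'| <= q + 2 * p + r.
Proof.
rewrite !ler_norml => /andP[? ?] /andP[? ?] /andP[? ?] ?.
by apply/andP; split; lra.
Qed.

Lemma geometric_dyadic (dim k : nat) : (0 < dim)%N ->
  (\sum_(j < k.+1) 2 ^ (j * dim) <= 2 * 2 ^ (k * dim))%N.
Proof.
move=> dim0; elim: k => [|k IH]; first by rewrite big_ord1 mul0n.
rewrite big_ord_recr/= mul2n -addnn leq_add2r (leq_trans IH)//.
rewrite [in leqRHS]mulSn expnD leq_mul2r; apply/orP; right.
by rewrite -[leqLHS](expn1 2) leq_exp2l.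
Qed.

Section lipschitz_entropy.
Variables (T : choiceType) (t0 : T) (R : realType) (dist : T -> T -> R).
Variables (A dim : nat) (delta D : R).
Hypotheses (dim0 : (0 < dim)%N) (delta0 : 0 <= delta) (D0 : 0 <= D).
Hypothesis gridT : grid_le dist A delta dim.

Let bnd := Num.bound (2 * delta + D + 2).

(** A function is encoded by its values at one point per cell, rounded to
    multiples of the scale.  Instead of the values themselves the code records
    the increments along the tree of cells, from a cell to the coarser cell that
    contains its chosen point: a Lipschitz function has boundedly many possible
    increments, so the number of codes is exponential in the number of cells,
    without a factor [k] in the exponent. *)
Lemma bounded_lip_entropy :
  entropy_le (bounded_lip dist D) (1 + 2 * delta + D) (4 * bnd * A)%:R dim.
Proof.
have [N /choice[cell cellP]] := choice gridT.
have bndP : 2 * delta + D + 2 < bnd%:R.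
  by apply: archi_boundP; rewrite !addr_ge0// mulr_ge0.
pose rep k c := xget (t0 : T) [set x | cell k x = c].
have repP k x : cell k (rep k (cell k x)) = cell k x.
  by apply: (@xgetPex _ t0 [set y | cell k y = cell k x]); exists x.
pose v k (f : T -> R) c : int := Num.floor (2 ^+ k * f (rep k c)).
have p0 k : 0 < 2 ^+ k :> R by rewrite exprn_gt0.
pose M := (bnd.*2).+1.
have floor_bnd (x : R) : `|x| <= 2 * delta + D -> (`|Num.floor x| <= bnd)%N.
  by move=> xb; exact: floor_bound bndP xb.
have incr_bnd k f x : bounded_lip dist D f ->
    (`|(v k.+1 f (cell k.+1 x)
        - 2 * v k f (cell k (rep k.+1 (cell k.+1 x))))%R| <= bnd)%N.
  move=> Lf; rewrite /v; set y := rep k.+1 _; set z := rep k _.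
  have yz : dist y z <= delta / 2 ^+ k.
    by have [_ _] := cellP k; apply; rewrite repP.
  apply: (floor_increment D0 bndP).
  have -> : 2 ^+ k.+1 * f y / 2 = 2 ^+ k * f y by rewrite exprS; field.
  by rewrite -mulrBr normrM gtr0_norm// mulrC -ler_pdivlMr// (le_trans (Lf.1 y z)).
have net k : exists (C : finType) (code : (T -> R) -> C),
    (#|C| <= M ^ (\sum_(j < k.+1) N j))%N /\
    forall f f', bounded_lip dist D f -> bounded_lip dist D f' ->
      code f = code f' -> forall x, v k f (cell k x) = v k f' (cell k x).
  (* integers of absolute value at most [bnd], shifted into ['I_(2 * bnd + 1)] *)
  pose enc (r : int) : 'I_M := inord `|(r + bnd%:Z)%R|.
  have decode (r s : int) : (`|r| <= bnd)%N -> (`|s| <= bnd)%N ->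
      enc r = enc s -> r = s.
    rewrite /enc => rb sb /(congr1 val); rewrite /= !inordK /M; lia.
  elim: k => [|k [C [code [Ccard codeP]]]].
    exists {ffun 'I_(N 0) -> 'I_M}, (fun f => [ffun c : 'I_(N 0) => enc (v 0 f c)]).
    split; first by rewrite card_ffun !card_ord big_ord1.
    move=> f f' Lf Lf' /ffunP ff' x.
    have [_ cN _] := cellP 0; have := ff' (Ordinal (cN x)); rewrite !ffunE /=.
    by apply: decode; apply: floor_bnd; rewrite expr0 mul1r;
      [rewrite (le_trans (Lf.2 _))//|rewrite (le_trans (Lf'.2 _))//];
      rewrite lerDr mulr_ge0.
  exists (C * {ffun 'I_(N k.+1) -> 'I_M})%type, (fun f => (code f,
    [ffun c : 'I_(N k.+1) => enc (v k.+1 f c - 2 * v k f (cell k (rep k.+1 c)))])).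
  split.
    rewrite card_prod card_ffun !card_ord big_ord_recr/= expnD.
    by rewrite leq_mul2r Ccard orbT.
  move=> f f' Lf Lf' [] /(codeP _ _ Lf Lf') vv /ffunP ff' x.
  have [_ cN _] := cellP k.+1; have := ff' (Ordinal (cN x)); rewrite !ffunE /=.
  move=> /(decode _ _ (incr_bnd _ _ _ Lf) (incr_bnd _ _ _ Lf')).
  by rewrite vv => /addIr.
move=> k; have [C [code [Ccard codeP]]] := net k.
exists #|C|, (fun f => nat_of_ord (enum_rank (code f))); split => //.
- apply: (@le_trans _ _ (M ^ (2 * A * 2 ^ (k * dim)))%:R).
    rewrite ler_nat (leq_trans Ccard)// leq_pexp2l//.
    apply: (@leq_trans (\sum_(j < k.+1) A * 2 ^ (j * dim))).
      by apply: leq_sum => j _; have [] := cellP j.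
    rewrite -big_distrr/= -mulnA mulnCA leq_mul2l orbC.
    by rewrite geometric_dyadic.
  rewrite natrX (_ : (4 * bnd * A)%:R * _ = (2 * A * 2 ^ (k * dim))%:R * (2 * bnd)%:R).
    rewrite expRM_natl lerXn2r ?nnegrE ?expR_ge0//.
    by rewrite (le_trans _ (expR_ge1Dx _))// /M -addn1 natrD addrC -mul2n.
  by rewrite -!natrM; congr (_%:R); lia.
- move=> f f' Lf Lf' /ord_inj/enum_rank_inj/(codeP _ _ Lf Lf') vv x.
  set y := rep k (cell k x).
  have xy : dist x y <= delta / 2 ^+ k.
    by have [_ _] := cellP k; apply; rewrite repP.
  have fy : `|f y - f' y| <= (2 ^+ k)^-1.
    have := vv x; rewrite /v -/y => e.
    have := floor_itv (2 ^+ k * f y); have := floor_itv (2 ^+ k * f' y).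
    rewrite e intrD; move: ((Num.floor (2 ^+ k * f' y))%:~R) => z.
    move=> /andP[h1 h2] /andP[h3 h4].
    have : `|2 ^+ k * (f y - f' y)| <= 1 by rewrite ler_norml; lra.
    by rewrite normrM gtr0_norm// mulrC -ler_pdivlMr// mul1r.
  have f1 := le_trans (Lf.1 x y) xy; have f2 := le_trans (Lf'.1 x y) xy.
  have -> : (1 + 2 * delta + D) / 2 ^+ k =
      (2 ^+ k)^-1 + 2 * (delta / 2 ^+ k) + D / 2 ^+ k by field; rewrite expf_neq0.
  have : 0 <= D / 2 ^+ k by rewrite divr_ge0// ltW.
  move: f1 f2 fy; set p := delta / _; set q := _^-1; set r := D / _.
  exact: three_steps.
Qed.

End lipschitz_entropy.

(** * The rate *)

Definition sample_rate (R : realType) (d n : nat) : R :=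
  if d == 1%N then n%:R `^ (- 2^-1)
  else if d == 2%N then n%:R `^ (- 2^-1) * ln n%:R
  else n%:R `^ (- d%:R^-1).

Lemma rateD (R : realType) (d n m : nat) :
  rate R d n m = sample_rate R d n + sample_rate R d m.
Proof. by rewrite /rate /sample_rate; case: ifP => // _; case: ifP. Qed.

Section chain_sum_rate.
Variable R : realType.
Let t (d n k : nat) : R := Num.sqrt ((2 ^ (k * d))%:R / n%:R) / 2 ^+ k.

Let t_ge0 d n k : 0 <= t d n k.
Proof. by rewrite divr_ge0 ?sqrtr_ge0// exprn_ge0. Qed.

Let tS d n k : t d n k.+1 = Num.sqrt (2 ^+ d) / 2 * t d n k.
Proof.
rewrite /t mulSn expnD natrM natrX -mulrA sqrtrM ?exprn_ge0//.
by rewrite exprS; field; rewrite expf_neq0.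
Qed.

Let t0 d n : (0 < n)%N -> t d n 0 = n%:R `^ (- 2^-1).
Proof.
move=> n0; rewrite /t mul0n expn0 expr0 divr1 mul1r powRN powR12_sqrt//.
by rewrite sqrtrV.
Qed.

(** The terms [t d n k] are geometric of ratio [sqrt (2 ^+ d) / 2], which is
    [1 / sqrt 2 < 3 / 4] for [d = 1] and at least [sqrt 2 > 4 / 3] for
    [d > 2]. *)
Let sum_decreasing d n K : Num.sqrt (2 ^+ d) / 2 <= 3 / 4 :> R ->
  chain_sum R d n K <= 4 * t d n 0.
Proof.
move=> s; suff : chain_sum R d n K <= 4 * t d n 0 - 3 * t d n K.
  by have := t_ge0 d n K; lra.
rewrite /chain_sum; elim: K => [|K IH]; first by rewrite big_ord1 -/(t d n 0); lra.
rewrite big_ord_recr/= -/(t d n K.+1).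
have : t d n K.+1 <= 3 / 4 * t d n K by rewrite tS ler_wpM2r.
by lra.
Qed.

Let sum_increasing d n K : 4 / 3 <= Num.sqrt (2 ^+ d) / 2 :> R ->
  chain_sum R d n K <= 4 * t d n K.
Proof.
move=> s; rewrite /chain_sum; elim: K => [|K IH].
  by rewrite big_ord1 -/(t d n 0); have := t_ge0 d n 0; lra.
rewrite big_ord_recr/= -/(t d n K.+1).
have : 4 / 3 * t d n K <= t d n K.+1 by rewrite tS ler_wpM2r.
by lra.
Qed.

(** The last scale [K] is the largest with [2 ^ (K * d) <= n]; its size [2 ^- K]
    is then at most [2 * n ^ (- 1 / d)], and the last term of the sum is at most
    [2 ^- K]. *)
Lemma chain_sum_rate (d : nat) : (0 < d)%N -> exists2 C : R, 0 < C &
  forall n, (0 < n)%N -> (d = 2%N -> (1 < n)%N) -> exists2 K,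
    (2 ^ (K * d) <= n)%N &
    chain_sum R d n K + (2 ^+ K)^-1 <= C * sample_rate R d n.
Proof.
move=> d0.
have [ln2 ln2E ln2_0] : exists2 l : R, l = ln 2 & 0 < l.
  by exists (ln 2) => //; rewrite ln_gt0// ltr1n.
exists (10 + 4 / ln2); first by rewrite addr_gt0// divr_gt0.
move=> n n0 d2; pose K := trunc_log (2 ^ d) n.
have b1 : (1 < 2 ^ d)%N by rewrite -{1}(expn0 2) ltn_exp2l.
have /andP[Kn nK] := trunc_log_bounds b1 n0.
rewrite -/K -!expnM in Kn nK.
have KnN : (2 ^ (K * d) <= n)%N by rewrite mulnC.
exists K => //.
have n1R : 1 <= n%:R :> R by rewrite ler1n.
have n0R : 0 < n%:R :> R by rewrite ltr0n.
have p0 : 0 < 2 ^+ K :> R by rewrite exprn_gt0.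
have dR0 : d%:R != 0 :> R by rewrite pnatr_eq0 -lt0n.
have scale : (2 ^+ K)^-1 <= 2 * n%:R `^ (- d%:R^-1) :> R.
  rewrite powRN ler_pdivlMr ?powR_gt0// ler_pdivrMl// -exprSr.
  have -> : 2 ^+ K.+1 = ((2 ^+ K.+1) ^+ d) `^ d%:R^-1 :> R.
    by rewrite -[_ ^+ d]powR_mulrn ?exprn_ge0// -powRrM divff// powRr1// exprn_ge0.
  rewrite ge0_ler_powR ?invr_ge0 ?nnegrE ?exprn_ge0//.
  by rewrite -exprM mulnC -natrX ler_nat ltnW.
have tK1 : t d n K <= (2 ^+ K)^-1.
  rewrite /t ler_pdivrMr// mulVf ?gt_eqF// -[leRHS]sqrtr1 ler_wsqrtr//.
  by rewrite ler_pdivrMr// mul1r ler_nat.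
have half : 0 < n%:R `^ (- 2^-1) :> R by rewrite powR_gt0.
rewrite /sample_rate; case: eqVneq => [d1|d1]; last case: eqVneq => [dd|dd].
- subst d.
  have s : Num.sqrt (2 ^+ 1) / 2 <= 3 / 4 :> R.
    have : Num.sqrt (2 ^+ 1) <= Num.sqrt ((3 / 2) ^+ 2) :> R.
      by apply: ler_wsqrtr; lra.
    by rewrite sqrtr_sqr ger0_norm; lra.
  have := sum_decreasing n K s; rewrite t0// => h.
  have : n%:R `^ (- 1%:R^-1) <= n%:R `^ (- 2^-1) :> R.
    by apply: ler_powR => //; rewrite invr1; lra.
  have : 0 <= 4 / ln2 * n%:R `^ (- 2^-1) by rewrite mulr_ge0 ?divr_ge0// ltW.
  by rewrite mulrDl; lra.
- subst d; have n2 := d2 erefl.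
  have csE : chain_sum R 2 n K = K.+1%:R * n%:R `^ (- 2^-1).
    rewrite /chain_sum (eq_bigr (fun=> n%:R `^ (- 2^-1))).
      by rewrite sumr_const card_ord mulr_natl.
    move=> k _; rewrite -/(t 2 n k) -(t0 2 n0).
    elim: (val k) => // j IH; rewrite tS -IH.
    by rewrite sqrtr_sqr ger0_norm// divff// mul1r.
  have ln_n : ln2 <= ln n%:R by rewrite ln2E ler_ln ?posrE// ler_nat.
  have lnK : K%:R * ln2 <= ln n%:R.
    rewrite ln2E mulr_natl -lnXn// ler_ln ?posrE ?exprn_gt0//.
    by rewrite -natrX ler_nat (leq_trans _ KnN)// leq_exp2l// leq_pmulr.
  rewrite csE.
  set h := n%:R `^ (- 2^-1) in half scale *.
  rewrite (_ : _ * (h * ln n%:R) = h * (10 * ln n%:R + 4 * (ln n%:R / ln2)));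
    last by field; rewrite gt_eqF.
  have l1 : 1 <= ln n%:R / ln2 by rewrite ler_pdivlMr// mul1r.
  have l2 : K%:R <= ln n%:R / ln2 by rewrite ler_pdivlMr.
  have l3 : 0 <= ln n%:R :> R by rewrite (le_trans (ltW ln2_0)).
  apply: (@le_trans _ _ (h * (K.+1%:R + 2))); first by rewrite mulrDr mulrC lerD2l mulrC.
  rewrite ler_pM2l// -natr1.
  by lra.
have d3 : (2 < d)%N by move: d0 d1 dd; case: (d) => [|[|[|]]].
have s : 4 / 3 <= Num.sqrt (2 ^+ d) / 2 :> R.
  have : Num.sqrt ((8 / 3) ^+ 2) <= Num.sqrt (2 ^+ d) :> R.
    apply: ler_wsqrtr; apply: (@le_trans _ _ (2 ^+ 3)); first by lra.
    by rewrite ler_eXn2l// ltr1n.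
  by rewrite sqrtr_sqr ger0_norm; lra.
have := sum_increasing n K s.
have : 0 <= 4 / ln2 * n%:R `^ (- d%:R^-1) by rewrite mulr_ge0 ?divr_ge0 ?powR_ge0// ltW.
by rewrite mulrDl; lra.
Qed.

End chain_sum_rate.

(** * Borel measurability in the weak topology *)

Section borel_functions.
Variables (R : realType) (T : ptopologicalType).

Lemma continuous_borel_measurable (f : T -> R) : continuous f ->
  measurable_fun [set: borel T] (f : borel T -> R).
Proof.
move=> cf; apply: (measurability _ (RGenOInfty.measurableE R)) => _ [_ [x ->] <-].
rewrite setTI; apply: sub_sigma_algebra.
by apply: open_comp => // *; exact: cf.
Qed.

End borel_functions.

Section weak_evaluation.
Variables (R : realType) (T : ptopologicalType).

Lemma continuous_weak_eval (f : T -> R) : continuous f -> bounded_fun f ->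
  continuous (fun P : Prob R T => \int[pmeas P]_(x in [set: borel T]) f x).
Proof.
move=> cf bf P; pose b : bcont R T := exist _ f (conj cf bf).
have := @continuous_comp (Prob R T) (prod_topology (fun _ : bcont R T => R)) R
  (@weak_eval R T) (proj b) P; apply.
  exact: (@initial_continuous _ _ (@weak_eval R T)).
exact: proj_continuous.
Qed.

Lemma measurable_weak_eval (f : T -> R) : continuous f -> bounded_fun f ->
  measurable_fun [set: borel (Prob R T)]
    (fun P : borel (Prob R T) => \int[pmeas P]_(x in [set: borel T]) f x).
Proof.
move=> cf bf.
exact: (@continuous_borel_measurable R (Prob R T) _ (continuous_weak_eval cf bf)).
Qed.

End weak_evaluation.

(** The property of metric topologies that makes masses of Borel sets
    measurable functions of the measure. *)
Definition open_approximable (R : realType) (T : topologicalType) : Prop :=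
  forall V : set T, open V -> exists f : nat -> T -> R,
  [/\ forall n, continuous (f n), forall n x, 0 <= f n x <= 1 &
      forall x, f n x @[n --> \oo] --> (\1_V x : R)].

Lemma pseudometric_open_approximable (R : realType) (W : pseudoMetricType R) :
  open_approximable R W.
Proof.
move=> V oV.
pose F n := [set x : W | ball x n.+1%:R^-1 `<=` V].
(* 0 outside [V], and 1 where the ball of radius 1 / (n + 1) lies in [V] *)
pose f n := @Urysohn W R (~` V) (F n).
have sep n : @uniform_separator W (~` V) (F n).
  apply: uniform_separatorW; exists [set xy | ball xy.1 n.+1%:R^-1 xy.2].
    by rewrite -entourage_ballE; exists n.+1%:R^-1 => //=.
  rewrite -subset0 => -[x y] /= [[nVx Fy] xy]; apply: nVx; apply: Fy.
  exact: ball_sym.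
exists f; split.
- by move=> n; exact: Urysohn_continuous.
- move=> n x; have := @Urysohn_range W R (~` V) (F n) (f n x).
  by rewrite /= in_itv/=; apply; exists x.
- move=> x; rewrite indicE; have [|] := boolP (x \in V).
    rewrite inE => Vx; apply: cvg_near_cst.
    have /nbhs_ballP[e /= e0 eV] : nbhs x V by exact: open_nbhs_nbhs.
    near=> n; apply: (@Urysohn_sub1 W R _ _ (sep n)); exists x => // y xy.
    apply: eV; apply: le_ball xy; apply: ltW; near: n.
    exact: (near_infty_natSinv_lt (PosNum e0)).
  move=> /negP; rewrite inE => Vx; apply: cvg_near_cst; apply: nearW => n.
  by apply: (@Urysohn_sub0 W R _ _ (sep n)); exists x.
Unshelve. all: by end_near. Qed.

Lemma msubset_val_continuous (W : topologicalType) (X : set W) (x0 : X) :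
  continuous (set_val : msubset x0 -> W).
Proof. exact: initial_continuous. Qed.

Lemma msubset_open_approximable (R : realType) (W : topologicalType) (X : set W)
  (x0 : X) : open_approximable R W -> open_approximable R (msubset x0).
Proof.
move=> aW U [V oV <-].
have [f [cf f01 fV]] := aW V oV.
exists (fun n => f n \o set_val); split.
- move=> n x; apply: continuous_comp; first exact: msubset_val_continuous.
  exact: cf.
- by move=> n x; exact: f01.
- by move=> x; exact: fV.
Qed.

Section mass_kernel.
Variables (R : realType) (T : ptopologicalType).
Hypothesis approxT : open_approximable R T.

(** Open sets are stable under intersection and generate the Borel sets, and the
    mass of an open set is a limit of integrals of continuous functions. *)
Lemma measurable_mass (B : set (borel T)) : measurable B ->
  measurable_fun [set: borel (Prob R T)] (fun P : borel (Prob R T) => pmeas P B).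
Proof.
move: B; apply: (@dynkin_induction _ (borel T) (@open T)) => //.
- by move=> A B; exact: openI.
- rewrite (_ : (fun P => _) = cst 1%E); first exact: measurable_cst.
  by apply/funext => P; exact: probability_setT.
- move=> V oV; have [f [cf f01 fV]] := approxT oV.
  have bf n : bounded_fun (f n).
    exists 1; split; first exact: num_real.
    move=> r r1 x _ /=; have /andP[? ?] := f01 n x.
    by rewrite ger0_norm// (le_trans _ (ltW r1)).
  apply: (@emeasurable_fun_cvg _ _ _ _ (fun n (P : borel (Prob R T)) =>
      (\int[pmeas P]_(x in [set: borel T]) f n x)%:E)).
    by move=> n; apply/measurable_EFinP; exact: measurable_weak_eval.
  move=> P _; have mf n : measurable_fun [set: borel T] (f n : borel T -> R).
    exact: continuous_borel_measurable.
  have mV : measurable (V : set (borel T)) by exact: sub_sigma_algebra.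
  have [|||||_ _] := @dominated_convergence _ _ _ (pmeas P) [set: borel T] measurableT
    (fun n x => (f n x)%:E) (fun x => (\1_V x)%:E) (cst 1%E).
  - by move=> n; exact/measurable_EFinP.
  - by apply/measurable_EFinP; exact: measurable_indic.
  - by apply: aeW => x _; apply/fine_cvgP; split; [exact: nearW|exact: fV].
  - exact: finite_measure_integrable_cst.
  - apply: aeW => x n _; have /andP[? ?] := f01 n x.
    by rewrite /= lee_fin ger0_norm.
  rewrite integral_indic// setIT; apply: cvg_trans; apply: near_eq_cvg.
  apply: nearW => n; rewrite /= /Rintegral fineK//; apply: integrable_fin_num => //.
  apply: measurable_bounded_integrable => //; first exact: fin_num_fun_lty.
  exact: bf.
- move=> S mS mPS.
  rewrite (_ : (fun P => _) = (fun P : borel (Prob R T) => 1 - pmeas P S)%E).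
    exact: emeasurable_funB.
  by apply/funext => P; exact: probability_setC.
- move=> F mF tF mPF.
  rewrite (_ : (fun P => _) = (fun P : borel (Prob R T) =>
      \sum_(0 <= k <oo) pmeas P (F k))%E).
    by apply: ge0_emeasurable_sum.
  apply/funext => P; apply/esym/cvg_lim => //.
  exact: measure_sigma_additive.
Qed.

End mass_kernel.

(** * Empirical measures *)

Section empirical_integral.
Context d (T : measurableType d) (R : realType).
Variables (k : nat) (k0 : (0 < k)%N) (x : 'I_k -> T).

Lemma ge0_integral_empirical (f : T -> \bar R) :
  measurable_fun [set: T] f -> (forall y, (0 <= f y)%E) ->
  (\int[empirical_prob R k0 x]_y f y = (k%:R^-1)%:E * \sum_(i < k) f (x i))%E.
Proof.
move=> mf f0.
have kge0 : 0 <= k%:R^-1 :> R by rewrite invr_ge0.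
pose s (j : nat) : {measure set T -> \bar R} := \d_(x (insubd (Ordinal k0) j)).
rewrite (@eq_measure_integral _ _ _ setT (mscale (NngNum kge0) (msum s k))); last first.
  move=> A mA _; rewrite /= /empirical_prob /= /empirical /mscale /msum/=.
  congr (_ * _)%E; apply: eq_bigr => i _; rewrite /s.
  by rewrite (_ : insubd _ _ = i)//; apply/val_inj; rewrite val_insubd ltn_ord.
rewrite ge0_integral_mscale// ge0_integral_measure_sum//; congr (_ * _)%E.
apply: eq_bigr => i _; rewrite integral_dirac// diracT mul1e; congr (f (x _)).
by apply/val_inj; rewrite val_insubd ltn_ord.
Qed.

Lemma Rintegral_empirical (f : T -> R) : measurable_fun [set: T] f ->
  \int[empirical_prob R k0 x]_y f y = k%:R^-1 * \sum_(i < k) f (x i).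
Proof.
move=> mf; pose p y := Num.max (f y) 0; pose q y := Num.max (- f y) 0.
have mp : measurable_fun [set: T] (fun y => (p y)%:E).
  by apply/measurable_EFinP; exact: measurable_maxr.
have mq : measurable_fun [set: T] (fun y => (q y)%:E).
  by apply/measurable_EFinP; apply: measurable_maxr => //; exact: measurableT_comp.
rewrite /Rintegral integralE (_ : _^\+ = EFin \o p)%E; last first.
  by apply/funext => y; rewrite funeposE /= -EFin_max.
rewrite (_ : _^\- = EFin \o q)%E; last first.
  by apply/funext => y; rewrite funenegE /= -EFin_max.
rewrite !ge0_integral_empirical//; last 2 first.
- by move=> y; rewrite lee_fin le_max lexx orbT.
- by move=> y; rewrite lee_fin le_max lexx orbT.
rewrite !sumEFin -!EFinM -EFinB /= -mulrBr -sumrB; congr (_ * _).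
apply: eq_bigr => i _; rewrite /p /q /Num.max.
by case: ltP => ?; case: ltP => ?; lra.
Qed.

End empirical_integral.

(** The integral of a nonnegative function is the supremum of the integrals of
    the simple functions below it, so an integrable majorant bounds it even
    when the function is not known to be measurable. *)
Lemma integral_le_majorant d (T : measurableType d) (R : realType)
    (mu : {measure set T -> \bar R}) (f g : T -> \bar R) :
  (forall x, (0 <= f x <= g x)%E) -> (\int[mu]_x f x <= \int[mu]_x g x)%E.
Proof.
move=> fg; rewrite !ge0_integralTE.
- apply: le_ereal_sup => _ [h hf <-]; exists h => // x.
  by rewrite (le_trans (hf x))//; have /andP[] := fg x.
- by move=> x; have /andP[h1 h2] := fg x; exact: le_trans h2.
- by move=> x; have /andP[] := fg x.
Qed.

(** * Lipschitz functions on a subset of Euclidean space *)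

Section euclidean_subset.
Variables (R : realType) (d : nat) (X : set 'rV[R]_d) (x0 : X).
Notation T := (msubset x0).
Notation dist := (@msubset_dist R d X x0).

Lemma eucl_dist_le_sum (x y : 'rV[R]_d) :
  eucl_dist x y <= \sum_(i < d) `|x ord0 i - y ord0 i|.
Proof.
rewrite /eucl_dist; pose a i : R := `|x ord0 i - y ord0 i|.
have -> : \sum_(i < d) (x ord0 i - y ord0 i) ^+ 2 = \sum_(i < d) a i ^+ 2.
  by apply: eq_bigr => i _; rewrite /a real_normK// num_real.
have a0 i : 0 <= a i by rewrite /a normr_ge0.
rewrite -[leRHS]ger0_norm ?sumr_ge0// -sqrtr_sqr ler_wsqrtr//.
elim: (index_enum _) => [|i r IH]; first by rewrite !big_nil expr0n lexx.
rewrite !big_cons sqrrD -addrA lerD2l (le_trans IH)// lerDr.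
by rewrite mulrn_wge0// mulr_ge0// sumr_ge0.
Qed.

Lemma coord_le_eucl_dist (x y : 'rV[R]_d) i :
  `|x ord0 i - y ord0 i| <= eucl_dist x y.
Proof.
rewrite /eucl_dist -sqrtr_sqr ler_wsqrtr// (bigD1 i)//= lerDl sumr_ge0// => j _.
exact: sqr_ge0.
Qed.

Lemma lip_continuous (f : T -> R) : Lip1 dist f -> continuous f.
Proof.
move=> Lf x; have FF : Filter (nbhs (x : T)) := @nbhs_filter T x.
apply/(@cvgrPdist_le _ _ _ _ FF) => e e0.
pose a : 'rV[R]_d := set_val x.
pose s (v : 'rV[R]_d) : R := \sum_(i < d) `|a ord0 i - v ord0 i|.
have cs : {for a, continuous s}.
  apply: (@cvg_big R _ +%R 0 _ (@add_continuous R) _ (nbhs a) _ _ _ (nbhs_filter a)) => i _.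
  apply: (@cvg_norm _ _ _ (nbhs a) (nbhs_filter a)).
  apply: (@cvgB _ _ _ (nbhs a) (nbhs_filter a)); first exact: cvg_cst.
  exact: coord_continuous.
have sa0 : s a = 0 by rewrite /s big1// => i _; rewrite subrr normr0.
have : (s \o (set_val : T -> _)) y @[y --> x] --> (0 : R).
  rewrite -sa0.
  exact: (@continuous_comp T _ _ set_val s x (@msubset_val_continuous _ X x0 x) cs).
move/(@cvgrPdist_le _ _ _ _ FF) => /(_ e e0); apply: filterS => y.
rewrite sub0r normrN => h; apply: (le_trans (Lf x y)).
apply: (le_trans (eucl_dist_le_sum _ _)); apply: le_trans h; exact: ler_norm.
Qed.

Lemma euclidean_open_approximable : open_approximable R T.
Proof. exact/msubset_open_approximable/pseudometric_open_approximable. Qed.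

Lemma euclidean_grid : ebounded X -> exists2 D : R, 0 < D &
  (forall x, dist x x0 <= D) /\ exists A, grid_le dist A d%:R d.
Proof.
move=> [D XD]; exists (Num.max D 1); first by rewrite lt_max ltr01 orbT.
have xD (x : T) : dist x x0 <= Num.max D 1.
  rewrite /msubset_dist le_max XD//; exact: set_valP.
split => //.
apply: (@coordinates_grid T R d (fun x i => set_val x ord0 i - set_val x0 ord0 i) dist
  (Num.max D 1)).
- by move=> x i; exact: le_trans (coord_le_eucl_dist _ _ _) (xD x).
- move=> x y; apply: (le_trans (eucl_dist_le_sum _ _)).
  by apply: ler_sum => i _; rewrite opprB addrA subrK.
Qed.

End euclidean_subset.

(** For the pseudo-distance between clamped points, Lipschitz functions on the
    whole line are determined by their values on a bounded interval. *)
Lemma clamp_grid (R : realType) (D : R) : 0 <= D ->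
  exists A, grid_le (fun y z => `|clamp (- D) D y - clamp (- D) D z|) A 1 1.
Proof.
move=> D0.
have DD : - D <= D by lra.
have [] := @coordinates_grid R R 1 (fun y _ => clamp (- D) D y)
  (fun y z => `|clamp (- D) D y - clamp (- D) D z|) D; last by move=> A gA; exists A.
- by move=> y _; rewrite ler_norml clamp_itv.
- by move=> y z; rewrite big_ord1.
Qed.

(** * Entropy of a two-parameter class *)

(** A function of the class is encoded by the codes of one chosen pair of
    parameters, which are combined as the two digits of a number in base
    [N2]. *)
Lemma entropy_le_pair (S1 S2 U : Type) (R : realType) (F1 : set (S1 -> R))
    (F2 : set (S2 -> R)) (B1 B2 a1 a2 : R) (dim : nat)
    (Phi : (S1 -> R) -> (S2 -> R) -> U -> R) :
  entropy_le F1 B1 a1 dim -> entropy_le F2 B2 a2 dim ->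
  (forall f f' g g' e1 e2, F1 f -> F1 f' -> F2 g -> F2 g' ->
    (forall x, `|f x - f' x| <= e1) -> (forall y, `|g y - g' y| <= e2) ->
    forall u, `|Phi f g u - Phi f' g' u| <= e1 + e2) ->
  entropy_le [set h | exists f g, [/\ F1 f, F2 g & h = Phi f g]]
    (B1 + B2) (a1 + a2) dim.
Proof.
move=> E1 E2 PhiL k.
have [N1 [c1 [N1a c1N c1E]]] := E1 k.
have [N2 [c2 [N2a c2N c2E]]] := E2 k.
have /choice [p pP] : forall h : U -> R, exists fg : (S1 -> R) * (S2 -> R),
    (exists f g, [/\ F1 f, F2 g & h = Phi f g]) ->
    [/\ F1 fg.1, F2 fg.2 & h = Phi fg.1 fg.2].
  move=> h; have [[f [g fgh]]|nh] := pselect (exists f g, [/\ F1 f, F2 g & h = Phi f g]).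
    by exists (f, g).
  by exists (cst 0, cst 0).
exists (N1 * N2)%N, (fun h => (c1 (p h).1 * N2 + c2 (p h).2)%N); split.
- by rewrite natrM mulrDl expRD ler_pM.
- move=> h /pP[h1 h2 _].
  apply: (@leq_trans ((c1 (p h).1).+1 * N2)).
    by rewrite mulSn addnC ltn_add2r c2N.
  by rewrite leq_mul2r c1N// orbT.
move=> h h' /pP[f1 f2 hE] /pP[f1' f2' hE'] e u; rewrite hE hE'.
have N20 : (0 < N2)%N by rewrite (leq_trans _ (c2N _ f2)).
rewrite mulrDl; apply: PhiL => //.
  apply: c1E => //; move: (congr1 (divn^~ N2) e).
  by rewrite !divnMDl// !divn_small ?addn0// c2N.
apply: c2E => //; move: (congr1 (modn^~ N2) e).
by rewrite !modnMDl !modn_small// c2N.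
Qed.

(** * Empirical process bounds *)

Section lipschitz_functionals.
Variables (R : realType) (d : nat) (X : set 'rV[R]_d) (x0 : X) (D : R).
Notation T := (msubset x0).
Notation dist := (@msubset_dist R d X x0).
Hypotheses (D0 : 0 < D) (distD : forall x, dist x x0 <= D).

Definition mean (f : T -> R) (P : Prob R T) : R :=
  \int[pmeas P]_(x in [set: borel T]) f x.

Definition clamp_dist (y z : R) : R := `|clamp (- D) D y - clamp (- D) D z|.

(** The functionals to which Kantorovich duality leads; the outer function is
    taken on [- D, D], where all the means lie, through [clamp_dist]. *)
Definition functional_class : set (Prob R T -> R) :=
  [set h | exists f g, [/\ bounded_lip dist D f, bounded_lip clamp_dist (2 * D) g &
    h = fun P => g (mean f P)]].

Lemma clamp_dist_le y z : clamp_dist y z <= `|y - z|.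
Proof.
have DD : - D <= D by have := D0; lra.
rewrite /clamp_dist; wlog yz : y z / z <= y.
  by move=> h; case: (leP z y) => [/h//|/ltW/h]; rewrite distrC (distrC z).
by rewrite !ger0_norm ?subr_ge0 ?clamp_nd// clampB.
Qed.

Section one_function.
Variable f : T -> R.
Hypothesis Lf : bounded_lip dist D f.

Lemma bounded_lip_continuous : continuous f.
Proof. exact: lip_continuous Lf.1. Qed.

Lemma bounded_lip_measurable : measurable_fun [set: borel T] (f : borel T -> R).
Proof. exact: continuous_borel_measurable bounded_lip_continuous. Qed.

Lemma bounded_lip_bounded : bounded_fun f.
Proof.
exists D; split; first exact: num_real.
by move=> r rD x _ /=; rewrite (le_trans (Lf.2 x))// ltW.
Qed.

Lemma mean_bound P : `|mean f P| <= D.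
Proof.
exact: (kernel_mean_bound (fun P : borel (Prob R T) => pmeas P)
  bounded_lip_measurable Lf.2 P).
Qed.

Lemma continuous_mean : continuous (mean f).
Proof. exact: continuous_weak_eval bounded_lip_continuous bounded_lip_bounded. Qed.

End one_function.

Section functional.
Variable h : Prob R T -> R.
Hypothesis Hh : functional_class h.

Lemma functional_measurable :
  measurable_fun [set: borel (Prob R T)] (h : borel (Prob R T) -> R).
Proof.
have [f [g [Lf Lg ->]]] := Hh.
apply: (@measurableT_comp _ _ _ _ _ _ g _ (mean f : borel (Prob R T) -> R)).
  apply: continuous_measurable_fun => y; apply/cvgrPdist_le => e e0; near=> z.
  apply: le_trans (Lg.1 _ _) _; apply: le_trans (clamp_dist_le _ _) _.
  by near: z; exact: cvgr_dist_le.
exact: (@continuous_borel_measurable R (Prob R T) _ (continuous_mean Lf)).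
Unshelve. all: by end_near. Qed.

Lemma functional_bound P : `|h P| <= 2 * D.
Proof. by have [f [g [Lf Lg ->]]] := Hh; exact: Lg.2. Qed.

Lemma functional_integrable (Q : Prob R (Prob R T)) :
  (pmeas Q).-integrable [set: borel (Prob R T)] (EFin \o (h : borel (Prob R T) -> R)).
Proof.
exact: (bounded_kernel_integrable (fun _ : unit => pmeas Q)
  functional_measurable functional_bound tt).
Qed.

End functional.

(** The dual potential turns the Wasserstein distance between the laws of
    [P f] into a difference of integrals of one functional of the class. *)
Lemma wasserstein1_law_le (Q1 Q2 : Prob R (Prob R T)) (f : T -> R) :
  Lip1 dist f -> exists (f' : T -> R) (g : R -> R),
  [/\ bounded_lip dist D f', bounded_lip clamp_dist (2 * D) g &
   (wasserstein1 (law_eval Q1 f) (law_eval Q2 f) <=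
    (\int[pmeas Q1]_P g (mean f' P) - \int[pmeas Q2]_P g (mean f' P))%:E)%E].
Proof.
move=> Lf; pose f' x := f x - f x0.
have Lf' : bounded_lip dist D f'.
  split => [x y|x]; first by rewrite /f' opprB addrA subrK; exact: Lf.
  exact: le_trans (Lf x x0) (distD x).
have fE P : \int[pmeas P]_(x in [set: borel T]) f x = mean f' P + f x0.
  rewrite /mean -[X in _ = _ + X]mulr1 -[X in _ * X]/(fine 1%E).
  rewrite -(@probability_setT _ _ _ (pmeas P)) -Rintegral_cst// -RintegralD//=.
  - by apply: eq_Rintegral => x _; rewrite /f' subrK.
  - exact: (bounded_kernel_integrable (fun P : borel (Prob R T) => pmeas P)
      (bounded_lip_measurable Lf') Lf'.2 P).
  - exact: finite_measure_integrable_cst.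
have mev : measurable_fun [set: borel (Prob R T)]
    (fun P : borel (Prob R T) => \int[pmeas P]_(x in [set: borel T]) f x).
  rewrite (_ : (fun P => _) = (fun P : borel (Prob R T) => mean f' P + f x0)).
    apply: measurable_funD => //.
    exact: (@continuous_borel_measurable R (Prob R T) _ (continuous_mean Lf')).
  by apply/funext => P; exact: fE.
pose ev : {mfun (borel (Prob R T)) >-> R} := mfun_of mev.
pose mu (Q : Prob R (Prob R T)) : probability R R := distribution (pmeas Q) ev.
pose l := f x0 - D; pose r := f x0 + D.
have evlr P : l <= ev P <= r.
  rewrite /ev/= fE; have := mean_bound Lf' P; rewrite ler_norml /l /r.
  by move=> /andP[? ?]; apply/andP; split; lra.
have mulr Q : mu Q `[l, r]%classic = 1%E.
  rewrite /mu /= /distribution /pushforward (_ : _ @^-1` _ = setT).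
    exact: (@probability_setT _ _ _ (pmeas Q)).
  by apply/seteqP; split => // P _; rewrite /= in_itv/=; exact: evlr.
pose pot := potential (mu Q1) (mu Q2) l r.
pose g y := pot (clamp (- D) D y + f x0).
have rl : r - l = 2 * D by rewrite /r /l; ring.
have Lg : bounded_lip clamp_dist (2 * D) g.
  split => [y z|y].
    rewrite (le_trans (potential_lip _ (mulr Q1) _ _))//.
    by rewrite /clamp_dist opprD addrACA subrr addr0.
  by rewrite -rl; exact: potential_bounded _ (mulr Q1) _.
exists f', g; split => //.
have Hh : functional_class (fun P => g (mean f' P)) by exists f', g.
have gE P : g (mean f' P) = pot (ev P).
  rewrite /g /ev /= fE clamp_id//.
  by have := mean_bound Lf' P; rewrite ler_norml.
have intE Q :
    (\int[mu Q]_y (pot y)%:E)%E = (\int[pmeas Q]_P g (mean f' P))%R%:E.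
  rewrite integral_distribution; last 2 first.
  - by apply/measurable_EFinP; exact: measurable_potential (mulr Q1).
  - have := functional_integrable Hh Q; congr (_.-integrable _ _).
    by apply/funext => P; rewrite /= gE.
  rewrite /Rintegral fineK; last exact: integrable_fin_num (functional_integrable Hh Q).
  by apply: eq_integral => P _; rewrite /= gE.
apply: (le_trans (wasserstein1_le_potential (mulr Q1) (mulr Q2))).
by rewrite -/pot !intE -EFinB.
Qed.

(** Means are 1-Lipschitz for the uniform distance and so is [g], hence codes of
    [f] and of [g] together determine [P |-> g (P f)] up to the sum of the two
    scales. *)
Lemma functional_entropy (dim : nat) (B1 B2 a1 a2 : R) :
  entropy_le (bounded_lip dist D) B1 a1 dim ->
  entropy_le (bounded_lip clamp_dist (2 * D)) B2 a2 dim ->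
  entropy_le functional_class (B1 + B2) (a1 + a2) dim.
Proof.
move=> E1 E2; apply: (entropy_le_pair (Phi := fun f g P => g (mean f P)) E1 E2).
move=> f f' g g' e1 e2 Lf Lf' Lg Lg' ff' gg' P.
have ff'P : `|mean f P - mean f' P| <= e1.
  rewrite /mean -RintegralB//; last 2 first.
  - exact: (bounded_kernel_integrable (fun P : borel (Prob R T) => pmeas P)
      (bounded_lip_measurable Lf) Lf.2 P).
  - exact: (bounded_kernel_integrable (fun P : borel (Prob R T) => pmeas P)
      (bounded_lip_measurable Lf') Lf'.2 P).
  apply: (kernel_mean_bound (fun P : borel (Prob R T) => pmeas P) _ ff' P).
  by apply: measurable_funB; apply: bounded_lip_measurable.
rewrite (_ : g _ - g' _ = (g (mean f P) - g (mean f' P)) +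
  (g (mean f' P) - g' (mean f' P))); last by ring.
rewrite (le_trans (ler_normD _ _))// lerD//.
by rewrite (le_trans (Lg.1 _ _))// (le_trans (clamp_dist_le _ _)).
Qed.

Section sample.
Context (dsp : measure_display) (Omega : measurableType dsp)
  (mu : probability Omega R).
Variables (n m : nat) (n0 : (0 < n)%N) (m0 : (0 < m)%N).
Variables (Pt : 'I_n -> {RV mu >-> borel (Prob R T)})
  (Xs : 'I_n -> 'I_m -> {RV mu >-> borel T}) (Q : Prob R (Prob R T)).
Hypothesis sampleQ : hierarchical_sample Pt Xs Q.

Let kmass : borel (Prob R T) -> probability (borel T) R := fun P => pmeas P.
Let kQ : unit -> probability (borel (Prob R T)) R := fun _ => pmeas Q.
Let tt_rv : {RV mu >-> unit} := mfun_of (@measurable_cst _ _ Omega unit setT tt).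

Lemma inner_conditionally_iid i (A : set (borel (Prob R T)))
    (B : 'I_m -> set (borel T)) :
  measurable A -> (forall j, measurable (B j)) ->
  mu (Pt i @^-1` A `&` \bigcap_j (Xs i j @^-1` B j)) =
  (\int[mu]_(w in Pt i @^-1` A) \prod_(j < m) kmass (Pt i w) (B j))%E.
Proof. exact: sample_cond_iid sampleQ i A B. Qed.

(** The outer sample is i.i.d. without conditioning, that is, conditionally on a
    constant. *)
Lemma outer_iid (A : set unit) (B : 'I_n -> set (borel (Prob R T))) :
  measurable A -> (forall i, measurable (B i)) ->
  mu (tt_rv @^-1` A `&` \bigcap_i (Pt i @^-1` B i)) =
  (\int[mu]_(w in tt_rv @^-1` A) \prod_(i < n) kQ (tt_rv w) (B i))%E.
Proof.
move=> mA mB.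
have prodE : (mu (\bigcap_i (Pt i @^-1` B i)) = \prod_(i < n) pmeas Q (B i))%E.
  have mE i : measurable (fst @^-1` B i : set (borel (Prob R T) * m.-tuple (borel T))).
    by rewrite -[X in measurable X]setTI; exact: measurable_fst.
  have -> : (\prod_(i < n) pmeas Q (B i) = \prod_(i < n) mu (Pt i @^-1` B i))%E.
    by apply: eq_bigr => i _; rewrite -(sample_law sampleQ i (mB i)).
  exact: (sample_indep sampleQ mE).
have [At|nAt] := pselect (A tt).
  rewrite (_ : tt_rv @^-1` A = setT); last by apply/seteqP; split.
  rewrite setTI prodE.
  rewrite -[RHS]/(\int[mu]_(w in [set: Omega]) cst (\prod_(i < n) pmeas Q (B i)) w)%E.
  by rewrite integral_cst// [X in (_ * X)%E](@probability_setT _ _ _ mu) mule1.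
rewrite (_ : tt_rv @^-1` A = set0); last by apply/seteqP; split.
by rewrite set0I measure0 integral_set0.
Qed.

(** The distance splits into the fluctuation of the [Pt i] around [Q] and the
    average fluctuation of the empirical measures around the [Pt i]. *)
Lemma d_Lip_le (Ga : Omega -> R) (Gb : 'I_n -> Omega -> R) w :
  (forall h, functional_class h -> deviation kQ tt_rv Pt h w <= Ga w) ->
  (forall i f, bounded_lip dist D f -> deviation kmass (Pt i) (Xs i) f w <= Gb i w) ->
  (d_Lip dist (empirical_hier Xs n0 m0 w) Q <=
   (Ga w + n%:R^-1 * \sum_(i < n) Gb i w)%:E)%E.
Proof.
move=> HGa HGb; apply: ge_ereal_sup => _ [f Lf <-].
have [f' [g [Lf' Lg W]]] := wasserstein1_law_le (empirical_hier Xs n0 m0 w) Q Lf.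
apply: (le_trans W); rewrite lee_fin.
have Hh : functional_class (fun P => g (mean f' P)) by exists f', g.
pose emp i : Prob R T := empirical_prob R m0 (fun j => Xs i j w).
have -> : \int[pmeas (empirical_hier Xs n0 m0 w)]_P g (mean f' P) =
    n%:R^-1 * \sum_(i < n) g (mean f' (emp i)).
  exact: (Rintegral_empirical n0 _ (functional_measurable Hh)).
have Nf' : bounded_lip dist D (fun x => 0 - f' x).
  split => [x y|x]; last by rewrite sub0r normrN; exact: Lf'.2.
  rewrite (_ : _ - _ = - (f' x - f' y)); first by rewrite normrN; exact: Lf'.1.
  by ring.
have inner i : `|mean f' (emp i) - mean f' (Pt i w)| <= Gb i w.
  have -> : mean f' (emp i) - mean f' (Pt i w) = deviation kmass (Pt i) (Xs i) f' w.
    by rewrite {1}/mean (Rintegral_empirical m0 _ (bounded_lip_measurable Lf')).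
  rewrite ler_norml HGb// andbT lerNl.
  have <- : deviation kmass (Pt i) (Xs i) (fun x => 0 - f' x) w =
      - deviation kmass (Pt i) (Xs i) f' w; last exact: HGb.
    rewrite (deviationB (b := D) kmass (Pt i) (Xs i) _
      (bounded_lip_measurable Lf') _ Lf'.2)//.
      rewrite [X in X - _](_ : _ = 0) ?sub0r// /deviation Rintegral_cst// mul0r subr0.
      by rewrite big1 ?mulr0.
    by move=> x; rewrite normr0 ltW.
have := HGa _ Hh; rewrite /deviation => Ha.
have : n%:R^-1 * \sum_(i < n) g (mean f' (emp i)) <=
    n%:R^-1 * \sum_(i < n) g (mean f' (Pt i w)) + n%:R^-1 * \sum_(i < n) Gb i w.
  rewrite -mulrDr ler_wpM2l ?invr_ge0// -big_split/= ler_sum// => i _.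
  rewrite -lerBlDl (le_trans (ler_norm _))// (le_trans (Lg.1 _ _))//.
  exact: le_trans (clamp_dist_le _ _) (inner i).
by lra.
Qed.

Lemma d_Lip_ge0 w : (0 <= d_Lip dist (empirical_hier Xs n0 m0 w) Q)%E.
Proof.
have L0 : Lip1 dist (cst 0).
  by move=> x y; rewrite /= subrr normr0 sqrtr_ge0.
apply: (@le_trans _ _ (wasserstein1 (law_eval (empirical_hier Xs n0 m0 w) (cst 0))
    (law_eval Q (cst 0)))).
  by apply: le_ereal_inf_tmp => _ [gam _ <-]; apply: integral_ge0.
by apply: ereal_sup_ubound; exists (cst 0).
Qed.

(** Chaining is applied to the functionals for the outer sample, and to the
    Lipschitz functions for each of the [n] inner samples. *)
Lemma expected_d_Lip (dim : nat) (B1 B2 a1 a2 : R) (Kn Km : nat) :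
  D <= B1 -> 2 * D <= B2 -> 0 <= a1 -> 0 <= a2 ->
  entropy_le (bounded_lip dist D) B1 a1 dim ->
  entropy_le (bounded_lip clamp_dist (2 * D)) B2 a2 dim ->
  (2 ^ (Kn * dim) <= n)%N -> (2 ^ (Km * dim) <= m)%N ->
  (\int[mu]_w d_Lip dist (empirical_hier Xs n0 m0 w) Q <=
    ((2 * (a1 + a2) + 3) * (3 * (B1 + B2)) * (chain_sum R dim n Kn + (2 ^+ Kn)^-1) +
     (2 * a1 + 3) * (3 * B1) * (chain_sum R dim m Km + (2 ^+ Km)^-1))%:E)%E.
Proof.
move=> DB1 DB2 a10 a20 E1 E2 hKn hKm.
have B10 : 0 < B1 by exact: lt_le_trans DB1.
have B0 : 0 < B1 + B2 by rewrite addr_gt0// (lt_le_trans _ DB2)// mulr_gt0.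
have mkQ (B : set (borel (Prob R T))) : measurable B ->
    measurable_fun [set: unit] (fun v => kQ v B) by move=> _; exact: measurable_cst.
have functional_bound' h : functional_class h -> forall P, `|h P| <= B1 + B2.
  move=> Hh P; rewrite (le_trans (functional_bound Hh P))//.
  by rewrite (le_trans DB2)// lerDr ltW.
have [Ga [mGa Ga0 GaP iGa]] := chaining mkQ outer_iid n0 B0 (addr_ge0 a10 a20)
  functional_measurable functional_bound' (functional_entropy E1 E2) hKn.
have lip_bound f : bounded_lip dist D f -> forall x, `|f x| <= B1.
  by move=> Lf x; exact: le_trans (Lf.2 x) DB1.
have mk (B : set (borel T)) : measurable B ->
    measurable_fun [set: borel (Prob R T)] (fun P => kmass P B).
  by apply: measurable_mass; exact: euclidean_open_approximable.
have /choice [Gb GbP] i := chaining mk (inner_conditionally_iid i) m0 B10 a10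
  bounded_lip_measurable lip_bound E1 hKm.
have n0R : 0 < n%:R :> R by rewrite ltr0n.
have mGb i : measurable_fun [set: Omega] (fun w => (Gb i w)%:E).
  by have [mG _ _ _] := GbP i; exact/measurable_EFinP.
have Gb0 i w : 0 <= Gb i w by have [_ G0 _ _] := GbP i.
apply: (@le_trans _ _
  (\int[mu]_w ((Ga w)%:E + (n%:R^-1)%:E * \sum_(i < n) (Gb i w)%:E))%E).
  apply: integral_le_majorant => w; rewrite d_Lip_ge0/= sumEFin -EFinM -EFinD.
  apply: d_Lip_le => [h Hh|i f Lf]; first exact: GaP.
  by have [_ _ GP _] := GbP i; exact: GP.
have mS : measurable_fun [set: Omega] (fun w => \sum_(i < n) (Gb i w)%:E)%E.
  by apply: emeasurable_sum.
rewrite ge0_integralD//; last 4 first.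
- by move=> w _; rewrite lee_fin.
- exact/measurable_EFinP.
- by move=> w _; rewrite mule_ge0 ?lee_fin ?invr_ge0// sume_ge0// => i _; rewrite lee_fin.
- exact: measurable_funeM.
rewrite EFinD leeD//.
rewrite ge0_integralZl_EFin ?invr_ge0//; last first.
  by move=> w _; rewrite sume_ge0// => i _; rewrite lee_fin.
rewrite ge0_integral_sum//; last by move=> i w _; rewrite lee_fin.
set c := (X in (_ <= X)%E).
apply: (@le_trans _ _ ((n%:R^-1)%:E * \sum_(i < n) c)%E).
  rewrite lee_wpmul2l ?lee_fin ?invr_ge0//.
  by apply: lee_sum => i _; have [_ _ _ iG] := GbP i.
rewrite sumEFin -EFinM sumr_const card_ord lee_fin.
by rewrite -[X in _ * X <= _]mulr_natl mulKf ?gt_eqF.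
Qed.

End sample.

End lipschitz_functionals.

Lemma sample_rate_ge0 (R : realType) (d n : nat) : (0 < n)%N ->
  0 <= sample_rate R d n.
Proof.
move=> n0; rewrite /sample_rate; case: ifP => _; first exact: powR_ge0.
by case: ifP => _; rewrite ?mulr_ge0 ?powR_ge0// ln_ge0// ler1n.
Qed.

Theorem theorem4p4 (R : realType) (d : nat) (d0 : (0 < d)%N)
    (X : set 'rV[R]_d) (x0 : X) (Xclosed : closed X) (Xbounded : ebounded X) :
  exists C : R, 0 < C /\
    forall (n m : nat) (n0 : (0 < n)%N) (m0 : (0 < m)%N),
    (* ln 1 = 0 makes the bound fail in dimension 2 for sample size 1 *)
    (d = 2%N -> (1 < n)%N /\ (1 < m)%N) ->
    forall (Q : Prob R (Prob R (msubset x0)))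
      (dsp : measure_display) (Omega : measurableType dsp)
      (mu : probability Omega R)
      (Pt : 'I_n -> {RV mu >-> borel (Prob R (msubset x0))})
      (Xs : 'I_n -> 'I_m -> {RV mu >-> borel (msubset x0)}),
    hierarchical_sample Pt Xs Q ->
    (\int[mu]_w d_Lip (@msubset_dist R d X x0) (empirical_hier Xs n0 m0 w) Q
      <= (C * rate R d n m)%:E)%E.
Proof.
have [D D0 [distD [A1 grid1]]] := euclidean_grid x0 Xbounded.
have [A2 /(grid_le_dim d0) grid2] := clamp_grid (ltW D0).
have DD0 : 0 <= 2 * D by rewrite mulr_ge0// ltW.
have E1 := bounded_lip_entropy x0 d0 (ler0n R d) (ltW D0) grid1.
have E2 := bounded_lip_entropy (0 : R) d0 ler01 DD0 grid2.
move: E1 E2; set B1 := (X in entropy_le _ X); set a1 := (X in entropy_le _ _ X).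
move=> E1; set B2 := (X in entropy_le _ X); set a2 := (X in entropy_le _ _ X) => E2.
have DB1 : D <= B1 by rewrite /B1 lerDr addr_ge0// mulr_ge0.
have DB2 : 2 * D <= B2 by rewrite /B2 lerDr addr_ge0// mulr_ge0.
have a10 : 0 <= a1 by [].
have a20 : 0 <= a2 by [].
have [C0 C00 HC] := chain_sum_rate R d0.
pose Aa := (2 * (a1 + a2) + 3) * (3 * (B1 + B2)).
pose Ab := (2 * a1 + 3) * (3 * B1).
have B10 : 0 < B1 by exact: lt_le_trans DB1.
have B0 : 0 < B1 + B2 by rewrite addr_gt0// (lt_le_trans _ DB2)// mulr_gt0.
have Aa0 : 0 < Aa by rewrite /Aa mulr_gt0 ?mulr_gt0// ltr_wpDl// mulr_ge0// addr_ge0.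
have Ab0 : 0 < Ab by rewrite /Ab mulr_gt0 ?mulr_gt0// ltr_wpDl// mulr_ge0.
exists ((Aa + Ab) * C0); split; first by rewrite mulr_gt0// addr_gt0.
move=> n m n0 m0 nm Q dsp Omega mu Pt Xs sampleQ.
have [Kn hKn chn] := HC n n0 (fun e => (nm e).1).
have [Km hKm chm] := HC m m0 (fun e => (nm e).2).
have := expected_d_Lip D0 distD n0 m0 sampleQ DB1 DB2 a10 a20 E1 E2 hKn hKm.
move=> /le_trans; apply; rewrite lee_fin rateD.
have rn : 0 <= sample_rate R d n by exact: sample_rate_ge0.
have rm : 0 <= sample_rate R d m by exact: sample_rate_ge0.
rewrite -/Aa -/Ab.
apply: (@le_trans _ _ (Aa * (C0 * sample_rate R d n) + Ab * (C0 * sample_rate R d m))).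
  by rewrite lerD// ler_pM2l.
rewrite -subr_ge0.
rewrite (_ : _ - _ = C0 * (Ab * sample_rate R d n + Aa * sample_rate R d m)); last by ring.
by rewrite mulr_ge0 ?(ltW C00)// addr_ge0// mulr_ge0// ltW.
Qed.
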